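(* Suppose $\psi$ is $\bar\mu$-strongly convex for some $\bar\mu>0$, and there is an optimal primal-dual pair $(z_*,p_* )$, i.e. $0\in\nabla\psi_s(z_* )+\partial\psi_n(z_* )+\mathcal A^*p_*$ and $\mathcal Az_*=b$, with $p_*$ attaining the optimal dual value. Assume O-IAL is run with inputs $z_0\in\operatorname{dom}\psi_n$, $p_0\in\mathbb R^m$, tolerances $(\hat\epsilon,\hat\rho)\in\mathbb R_{++}^2$, penalty parameter $c=1/\hat\epsilon$, and that in each of its iterations $k$ it calls R-FISTA as subproblem solver with inputs $\chi\in(0,1)$, $\mu_0\ge\bar\mu$, $\bar M_0=M_0$, tolerance $\min\{\hat\epsilon/(4D),\hat\rho\}$, function pair $(\mathcal L_c^s(\cdot,p_{k-1}),\psi_n)$ and initial point $z_{k-1}$. Then O-IAL performs at most $$\mathcal O_1\left(\Pi(p_0)\left\lceil\log_2^{++}(\mu_0/\bar\mu)\right\rceil\left[\sqrt{\frac{\bar L+\|\mathcal A\|^2/\hat\epsilon}{\bar\mu}}\,\log^{++}\left(\frac{D(\bar L+\|\mathcal A\|^2/\hat\epsilon)}{\min\{\hat\epsilon/(4D),\hat\rho\}}\right)+\log_2^+\left(\frac{\bar L+\|\mathcal A\|^2/\hat\epsilon}{\bar M_0}\right)\right]\right)$$ gradient evaluations to obtain an $(\hat\epsilon,\hat\rho)$-approximate solution, i.e. a triple $(z,p,r)$ with $r\in\nabla\psi_s(z)+\partial\psi_n(z)+\mathcal A^*p$, $\|r\|\le\hat\rho$, $\|\mathcal Az-b\|\le\hat\epsilon$.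 Consequently, O-IAL performs at most $\mathcal O(\hat\epsilon^{-1/2}\log(1/\hat\epsilon))$ total gradient evaluations to obtain an $(\hat\epsilon,\hat\epsilon)$-approximate solution.
   Context: Problem: $\min\{\psi(z):=\psi_s(z)+\psi_n(z):\mathcal Az=b\}$, where $\mathbb E$ is a finite-dimensional Euclidean space, $\mathcal A:\mathbb E\to\mathbb R^m$ is a nonzero linear map with adjoint $\mathcal A^*$, $b\in\mathbb R^m$; $\psi_s:\mathbb E\to\mathbb R$ is convex and differentiable with $\bar L$-Lipschitz gradient; $\psi_n$ is closed proper convex with compact convex domain $\operatorname{dom}\psi_n$ of diameter $D$. $\mathcal L_c^s(z,p)=\psi_s(z)+\langle p,\mathcal Az-b\rangle+\frac c2\|\mathcal Az-b\|^2$. $\mathcal P_\star$ is the set of optimal dual solutions, i.e. maximizers of the dual function $p\mapsto\min_z\{\psi(z)+\langle p,\mathcal Az-b\rangle\}$, and $\Pi(p)=\operatorname{dist}^2(p,\mathcal P_\star)$. $M_0=\|\nabla\psi_s(z_0)-\nabla\psi_s(w_0)\|/(4\|z_0-w_0\|)$ with $w_0\in\operatorname{dom}\psi_n$, $w_0\ne z_0$, $\nabla\psi_s(w_0)\ne\nabla\psi_s(z_0)$ (if $\psi_s$ is affine, $M_0>0$ is arbitrary and $\bar L$ is taken large enough that $M_0\le2\bar L$). O-IAL with R-FISTA: for $k=1,2,\dots$: run R-FISTA with the inputs listed in the claim and call its output $(z_k,r_k)$; set $p_k=p_{k-1}+c(\mathcal Az_k-b)$; stop as soon as $\|\mathcal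 Az_k-b\|\le\hat\epsilon$ and output $(z_k,p_k,r_k)$. R-FISTA for a generic pair $(f,h)$, $f$ convex with Lipschitz gradient, $h$ closed proper convex with compact domain (inputs $\chi\in(0,1)$, $(\mu_0,\bar M_0)\in\mathbb R_{++}^2$, tolerance $\epsilon>0$, $(f,h)$, $\bar x_0\in\operatorname{dom}h$). With $\ell_f(z;\bar z)=f(\bar z)+\langle\nabla f(\bar z),z-\bar z\rangle$, it runs cycles $\ell=1,2,\dots$. Initialization of cycle $\ell$: choose $\underline M_\ell\in[\max\{0.25\bar M_{\ell-1},\bar M_0\},\bar M_{\ell-1}]$, set $\tilde\mu=\mu_{\ell-1}$, $(A_0,\tau_0,L_0)=(0,1,\underline M_\ell)$, choose $x_0\in\operatorname{dom}h$ (with $x_0=\bar x_0$ if $\ell=1$), $y_0=x_0$. For $j=1,2,\dots$: (1) set $L_j=L_{j-1}$ and compute $a_{j-1}=\frac{\tau_{j-1}+\sqrt{\tau_{j-1}^2+4\tau_{j-1}A_{j-1}L_j}}{2L_j}$, $\tilde x_{j-1}=\frac{A_{j-1}y_{j-1}+a_{j-1}x_{j-1}}{A_{j-1}+a_{j-1}}$, $y_j=\operatorname{prox}_{(1/L_j)h}(\tilde x_{j-1}-\frac1{L_j}\nabla f(\tilde x_{j-1}))$; while $\ell_f(y_j;\tilde x_{j-1})+\frac{(1-\chi)L_j}{4}\|y_j-\tilde x_{j-1}\|^2<f(y_j)$, replace $L_j$ by $2L_j$ and recompute; (2) set $A_j=A_{j-1}+a_{j-1}$, $\tau_j=\tau_{j-1}+\frac{a_{j-1}\tilde\mu}2$,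 $s_j=L_j(\tilde x_{j-1}-y_j)$, $x_j=\frac1{\tau_j}\left[\frac{\tilde\mu a_{j-1}y_j}2+\tau_{j-1}x_{j-1}-a_{j-1}s_j\right]$, $v_j=\nabla f(y_j)-\nabla f(\tilde x_{j-1})+s_j$; (3) if $\|y_j-x_0\|^2\ge\chi A_jL_j\|y_j-\tilde x_{j-1}\|^2$ fails, set $\bar M_\ell=L_j$, $\mu_\ell=0.5\tilde\mu$ and start cycle $\ell+1$; otherwise, if $\|v_j\|\le\epsilon$, stop and output $(y_j,v_j)$. Notation: $\log_b^+(t)=\max\{\log_bt,0\}$, $\log_b^{++}(t)=\max\{\log_bt,1\}$, natural log if no base; $\mathcal O_1(\cdot)=\mathcal O(1+\cdot)$.
   Formalization: The displayed bound fails uniformly as Π(p_0) or κ=(L̄+‖A‖²/ε̂)/μ̄ tends to 0; its constant may depend on χ and positive lower bounds of Π(p_0) and κ. A second bound uses max(Π(p_0),1), max(κ,1) with a constant depending on χ only. E is R^n. *)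

(* Defs.v *)
From HB Require Import structures.
From mathcomp Require Import all_boot all_order all_algebra.
From mathcomp Require Import all_classical all_reals all_analysis.

Set Implicit Arguments.
Unset Strict Implicit.
Unset Printing Implicit Defensive.

Import Order.TTheory GRing.Theory Num.Theory.
Import numFieldNormedType.Exports.

Local Open Scope classical_set_scope.
Local Open Scope ring_scope.

(* A finite-dimensional Euclidean space is 'cV[R]_n with the standard inner
   product.  The norm `|x| of the library on 'cV[R]_n is the sup norm, hence
   [enorm]; the two norms induce the same topology, so that differentiability,
   compactness and semicontinuity are taken from the library. *)
Section Euclidean.
Context {R : realType}.

Definition dot n (x y : 'cV[R]_n) : R := \sum_i x i 0 * y i 0.

Definition enorm n (x : 'cV[R]_n) : R := Num.sqrt (dot x x).

Definition opnorm m n (A : 'M[R]_(m, n)) : R :=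
  sup [set enorm (A *m x) | x in [set x : 'cV[R]_n | enorm x <= 1]].

Definition diameter n (S : set 'cV[R]_n) : R :=
  sup [set enorm (x - y) | x in S & y in S].

Definition dist n (x : 'cV[R]_n) (S : set 'cV[R]_n) : R :=
  inf [set enorm (x - y) | y in S].

Definition grad n (f : 'cV[R]_n -> R) (x : 'cV[R]_n) : 'cV[R]_n :=
  \col_i 'D_(delta_mx i 0) f x.

Definition lipschitz_grad n (L : R) (f : 'cV[R]_n -> R) : Prop :=
  forall x y, enorm (grad f x - grad f y) <= L * enorm (x - y).

Definition affine_function n (f : 'cV[R]_n -> R) : Prop :=
  exists (g : 'cV[R]_n) (a : R), forall x, f x = dot g x + a.

End Euclidean.

Section ConvexAnalysis.
Context {R : realType} {n : nat}.
Local Notation E := 'cV[R]_n.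
Local Open Scope ereal_scope.
Implicit Types (h : E -> \bar R) (x y z : E).

Definition edom h : set E := [set x | h x < +oo].

Definition proper h : Prop := (forall x, h x != -oo) /\ edom h !=set0.

Definition econvex h : Prop :=
  forall x y (t : R), (0 < t < 1)%R ->
    h (t *: x + (1 - t) *: y)%R <= t%:E * h x + (1 - t)%:E * h y.

Definition strongly_convex (mu : R) h : Prop :=
  econvex (fun z => h z - (mu / 2 * enorm z ^+ 2)%:E).

Definition subdiff h z : set E :=
  [set g | forall u, h z + (dot g (u - z)%R)%:E <= h u].

(* y is the minimizer of lam * h + |. - w|^2 / 2 *)
Definition is_prox (lam : R) h (w y : E) : Prop :=
  forall u, lam%:E * h y + (enorm (y - w)%R ^+ 2 / 2)%:E
         <= lam%:E * h u + (enorm (u - w)%R ^+ 2 / 2)%:E.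

End ConvexAnalysis.

Section RFISTA.
Context {R : realType} {n : nat}.
Local Notation E := 'cV[R]_n.

(* The configuration of a cycle before a trial of the j-th iteration:
   (A_{j-1}, tau_{j-1}, x_{j-1}, y_{j-1}), the current trial value of L_j,
   and the data mu and x_0 of the cycle. *)
Record fista_state := FistaState {
  fs_mu : R;
  fs_x0 : E;
  fs_A : R;
  fs_tau : R;
  fs_L : R;
  fs_x : E;
  fs_y : E }.

Definition cycle_start (mu M : R) (x0 : E) : fista_state :=
  FistaState mu x0 0 1 M x0 x0.

Definition double_L (s : fista_state) : fista_state :=
  FistaState (fs_mu s) (fs_x0 s) (fs_A s) (fs_tau s) (2 * fs_L s)
    (fs_x s) (fs_y s).

Definition fs_a (s : fista_state) : R :=
  (fs_tau s + Num.sqrt (fs_tau s ^+ 2 + 4 * fs_tau s * fs_A s * fs_L s))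
    / (2 * fs_L s).

Definition fs_xtilde (s : fista_state) : E :=
  (fs_A s + fs_a s)^-1 *: (fs_A s *: fs_y s + fs_a s *: fs_x s).

Definition fs_nextA (s : fista_state) : R := fs_A s + fs_a s.

Definition fs_nexttau (s : fista_state) : R :=
  fs_tau s + fs_a s * fs_mu s / 2.

Definition fs_s (s : fista_state) (y : E) : E :=
  fs_L s *: (fs_xtilde s - y).

Definition fs_nextx (s : fista_state) (y : E) : E :=
  (fs_nexttau s)^-1 *: ((fs_mu s * fs_a s / 2) *: y + fs_tau s *: fs_x s
                          - fs_a s *: fs_s s y).

Definition fs_next (s : fista_state) (y : E) : fista_state :=
  FistaState (fs_mu s) (fs_x0 s) (fs_nextA s) (fs_nexttau s) (fs_L s)
    (fs_nextx s y) y.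

Context (chi M0 eps : R) (f : E -> R) (h : E -> \bar R).

Definition linearization (z w : E) : R := f w + dot (grad f w) (z - w).

Definition trial_point (s : fista_state) (y : E) : Prop :=
  is_prox (fs_L s)^-1 h
    (fs_xtilde s - (fs_L s)^-1 *: grad f (fs_xtilde s)) y.

Definition trial_fails (s : fista_state) (y : E) : Prop :=
  linearization y (fs_xtilde s)
    + (1 - chi) * fs_L s / 4 * enorm (y - fs_xtilde s) ^+ 2 < f y.

Definition fs_v (s : fista_state) (y : E) : E :=
  grad f y - grad f (fs_xtilde s) + fs_s s y.

Definition cycle_test (s : fista_state) (y : E) : Prop :=
  chi * fs_nextA s * fs_L s * enorm (y - fs_xtilde s) ^+ 2
    <= enorm (y - fs_x0 s) ^+ 2.

(* [rfista_step s k s'] is a possible trial from s, with k gradient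
   evaluations: one at xtilde, and, when the trial point y is accepted, one
   more at y for the residual v.  The outcome is the next configuration or the
   output (y, v). *)
Inductive rfista_step (s : fista_state) :
    nat -> fista_state + (E * E) -> Prop :=
| RFistaDouble y :
    trial_point s y -> trial_fails s y ->
    rfista_step s 1 (inl (double_L s))
| RFistaRestart y M x0 :
    trial_point s y -> ~ trial_fails s y -> ~ cycle_test s y ->
    Num.max (fs_L s / 4) M0 <= M <= fs_L s -> edom h x0 ->
    rfista_step s 2 (inl (cycle_start (fs_mu s / 2) M x0))
| RFistaNext y :
    trial_point s y -> ~ trial_fails s y -> cycle_test s y ->
    eps < enorm (fs_v s y) ->
    rfista_step s 2 (inl (fs_next s y))
| RFistaStop y :
    trial_point s y -> ~ trial_fails s y -> cycle_test s y ->
    enorm (fs_v s y) <= eps ->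
    rfista_step s 2 (inr (y, fs_v s y)).

End RFISTA.

Arguments fista_state : clear implicits.

Section Problem.
Context {R : realType}.

Record problem (n m : nat) := Problem {
  psi_s : 'cV[R]_n -> R;
  psi_n : 'cV[R]_n -> \bar R;
  Amap : 'M[R]_(m, n);
  bvec : 'cV[R]_m;
  Lbar : R }.

Context {n m : nat} (P : problem n m).
Local Notation E := 'cV[R]_n.
Local Notation A := (Amap P).
Local Notation b := (bvec P).

Record standing_assumptions : Prop := StandingAssumptions {
  Amap_neq0 : A != 0;
  psi_s_convex : convex_function [set: E] (psi_s P);
  psi_s_differentiable : forall z, differentiable (psi_s P) z;
  psi_s_lipschitz : lipschitz_grad (Lbar P) (psi_s P);
  psi_n_closed : lower_semicontinuous (psi_n P);
  psi_n_proper : proper (psi_n P);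
  psi_n_convex : econvex (psi_n P);
  psi_n_dom_compact : compact (edom (psi_n P)) }.

Definition psi (z : E) : \bar R := ((psi_s P z)%:E + psi_n P z)%E.

Definition dom_diam : R := diameter (edom (psi_n P)).

Definition dual (p : 'cV[R]_m) : \bar R :=
  ereal_inf (range (fun z : E => psi z + (dot p (A *m z - b)%R)%:E)%E).

Definition dual_solutions : set 'cV[R]_m :=
  [set p | forall q, (dual q <= dual p)%E].

Definition dual_dist2 (p : 'cV[R]_m) : R := dist p dual_solutions ^+ 2.

(* r \in grad psi_s z + subdiff psi_n z + A^T p *)
Definition kkt_residual (z : E) (p : 'cV[R]_m) (r : E) : Prop :=
  subdiff (psi_n P) z (r - grad (psi_s P) z - A^T *m p).

Definition optimal_pair (z : E) (p : 'cV[R]_m) : Prop :=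
  [/\ kkt_residual z p 0, A *m z = b & dual_solutions p].

Definition approximate_solution (eps rho : R) (z : E) (p : 'cV[R]_m) (r : E) :
    Prop :=
  [/\ kkt_residual z p r, enorm r <= rho & enorm (A *m z - b) <= eps].

Definition smooth_lagrangian (c : R) (p : 'cV[R]_m) (z : E) : R :=
  psi_s P z + dot p (A *m z - b) + c / 2 * enorm (A *m z - b) ^+ 2.

Definition initial_estimate (z0 : E) (M0 : R) : Prop :=
  (exists w0 : E,
     [/\ edom (psi_n P) w0, w0 != z0, grad (psi_s P) w0 != grad (psi_s P) z0 &
       M0 = enorm (grad (psi_s P) z0 - grad (psi_s P) w0)
              / (4 * enorm (z0 - w0))])
  \/ [/\ affine_function (psi_s P), 0 < M0 & M0 <= 2 * Lbar P].

Record oial_setting (mubar mu0 M0 : R) (z0 : E) : Prop := OialSetting {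
  setting_standing : standing_assumptions;
  setting_mubar : 0 < mubar;
  setting_strong : strongly_convex mubar psi;
  setting_optimal : exists z p, optimal_pair z p;
  setting_z0 : edom (psi_n P) z0;
  setting_mu0 : mubar <= mu0;
  setting_M0 : initial_estimate z0 M0 }.

Definition subproblem_tol (eps rho : R) : R :=
  Num.min (eps / (4 * dom_diam)) rho.

(* [OialRun p s]: R-FISTA is in configuration s on the subproblem with
   multiplier p (p_{k-1} in the k-th iteration). *)
Inductive oial_state :=
| OialRun of 'cV[R]_m & fista_state R n
| OialDone of E & 'cV[R]_m & E.

Context (chi mu0 M0 eps rho : R).
Local Notation c := (eps^-1).
Local Notation rstep p :=
  (rfista_step chi M0 (subproblem_tol eps rho) (smooth_lagrangian c p)
     (psi_n P)).

(* In the first cycle of R-FISTA the interval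
   [max(0.25 Mbar_0, Mbar_0), Mbar_0] for the initial estimate is {Mbar_0}. *)
Definition oial_start (p : 'cV[R]_m) (z : E) : oial_state :=
  OialRun p (cycle_start mu0 M0 z).

Definition next_multiplier (p : 'cV[R]_m) (z : E) : 'cV[R]_m :=
  p + c *: (A *m z - b).

Inductive oial_step : oial_state -> nat -> oial_state -> Prop :=
| OialInner p s k s' :
    rstep p s k (inl s') -> oial_step (OialRun p s) k (OialRun p s')
| OialNext p s k z r :
    rstep p s k (inr (z, r)) -> eps < enorm (A *m z - b) ->
    oial_step (OialRun p s) k (oial_start (next_multiplier p z) z)
| OialStop p s k z r :
    rstep p s k (inr (z, r)) -> enorm (A *m z - b) <= eps ->
    oial_step (OialRun p s) k (OialDone z (next_multiplier p z) r).

Inductive oial_exec (z0 : E) (p0 : 'cV[R]_m) : nat -> oial_state -> Prop :=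
| OialExec0 : oial_exec z0 p0 0 (oial_start p0 z0)
| OialExecS N st k st' :
    oial_exec z0 p0 N st -> oial_step st k st' ->
    oial_exec z0 p0 (N + k) st'.

(* Whatever the choices made along the way, the method performs at most B
   gradient evaluations, never gets stuck, and only stops with an
   (eps, rho)-approximate solution.  Every step costs at least one gradient
   evaluation, so every execution terminates. *)
Definition oial_solves_within (z0 : E) (p0 : 'cV[R]_m) (B : R) : Prop :=
  forall N st, oial_exec z0 p0 N st ->
    N%:R <= B /\
    match st with
    | OialRun _ _ => exists k st', oial_step st k st'
    | OialDone z p r => approximate_solution eps rho z p r
    end.

(* Lipschitz constant of the gradient of smooth_lagrangian with c = 1 / eps *)
Definition lagrangian_L : R := Lbar P + opnorm A ^+ 2 / eps.

End Problem.

Arguments problem : clear implicits.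

Section Bound.
Context {R : realType}.

Definition log2 (t : R) : R := ln t / ln 2.
Definition log2p (t : R) : R := Num.max (log2 t) 0.
Definition log2pp (t : R) : R := Num.max (log2 t) 1.
Definition lnpp (t : R) : R := Num.max (ln t) 1.

Definition oial_bound (Pi0 mu_ratio kappa D L tol M0 : R) : R :=
  Pi0 * (Num.ceil (log2pp mu_ratio))%:~R
    * (Num.sqrt kappa * lnpp (D * L / tol) + log2p (L / M0)).

End Bound.

(* Main.v *)
Require Import Defs.
From HB Require Import structures.
From mathcomp Require Import all_boot all_order all_algebra.
From mathcomp Require Import all_classical all_reals all_analysis.
From mathcomp Require Import ring lra.

Set Implicit Arguments.
Unset Strict Implicit.
Unset Printing Implicit Defensive.

Import Order.TTheory GRing.Theory Num.Theory.
Import numFieldNormedType.Exports.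

Local Open Scope classical_set_scope.
Local Open Scope ring_scope.

(** The method is a proximal point method on the dual function, carried out
    inexactly: its subproblems are solved by an accelerated gradient method
    that restarts with a smaller estimate [mu] of the modulus of strong
    convexity.  Its cost is the product of three numbers.

    Outer iterations.  If [r] is the residual of the subproblem solved at [z],
    with [|r| <= eps / (4 D)], then [A z - b] is an [eps / 4]-supergradient of
    the dual function at the new multiplier [p' = p + (A z - b) / eps]
    ([dual_le], [dual_ge]).  Hence, for every dual solution [p*],
    [|p' - p*|^2 + |A z - b|^2 / eps^2 <= |p - p*|^2 + 1/2]
    ([multiplier_contraction]).  As long as [|A z - b| > eps], the squared
    distance to all dual solutions thus drops by at least 1/2, which can happen
    at most [2 Pi(p0)] times ([multiplier_decrease], [decrease_count_le]).

    Cycles per subproblem.  Let [phi] be the objective of the subproblem.  As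
    long as [mu <= mubar], the iterates of a cycle satisfy
    [A_j phi(y_j) + tau_j/2 |u - x_j|^2 <= A_j phi(u) + |u - x_0|^2 / 2], and
    in fact with room for the term [chi/2 A_j L_j |y_j - xt|^2] on the left,
    where [xt] is the extrapolated point ([estimate_next]).  For [u = y_j] this
    is the test that keeps the cycle going ([estimate_cycle_test]).  So
    only cycles with [mu > mubar] are abandoned, and as each of them halves
    [mu], there are at most [log2 (mu0 / mubar)] of them, rounded up
    ([restart_le]), and [mu >= mubar / 2] throughout.

    Iterations per cycle.  Backtracking keeps [L_j] below a multiple of the
    Lipschitz constant ([double_step_max]).  The recursion for [A_j] makes
    [A_j L_j] grow by a factor [1 + sqrt (mubar / (4 Lmax))] at least
    ([nextA_growth]), while the test bounds the residual by
    [(Lf + L_j) D / sqrt (chi A_j L_j)] ([iteration_le]).  The tolerance is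
    reached after about [sqrt (L / mubar) log (D L / tol)] iterations.

    The method never gets stuck because the proximal problems have solutions:
    a lower semicontinuous function attains its minimum on a compact domain
    ([exists_minimizer]).  The remaining work is to put these counts into
    closed form ([run_cost_le], [small_tolerance_cost]). *)

(** * Inner product and norms *)

Section InnerProduct.
Context {R : realType}.
Implicit Types (n m : nat).

Lemma dotC n (x y : 'cV[R]_n) : dot x y = dot y x.
Proof. by apply: eq_bigr => i _; rewrite mulrC. Qed.

Lemma dotDl n (x y z : 'cV[R]_n) : dot (x + y) z = dot x z + dot y z.
Proof. by rewrite /dot -big_split; apply: eq_bigr => i _; rewrite !mxE mulrDl. Qed.

Lemma dotDr n (x y z : 'cV[R]_n) : dot z (x + y) = dot z x + dot z y.
Proof. by rewrite !(dotC z) dotDl. Qed.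

Lemma dotZl n (a : R) (x y : 'cV[R]_n) : dot (a *: x) y = a * dot x y.
Proof. by rewrite /dot mulr_sumr; apply: eq_bigr => i _; rewrite !mxE mulrA. Qed.

Lemma dotZr n (a : R) (x y : 'cV[R]_n) : dot y (a *: x) = a * dot y x.
Proof. by rewrite !(dotC y) dotZl. Qed.

Lemma dotNl n (x y : 'cV[R]_n) : dot (- x) y = - dot x y.
Proof. by rewrite -scaleN1r dotZl mulN1r. Qed.

Lemma dotNr n (x y : 'cV[R]_n) : dot y (- x) = - dot y x.
Proof. by rewrite !(dotC y) dotNl. Qed.

Definition dotE := (dotDl, dotDr, dotNl, dotNr, dotZl, dotZr).

Lemma dot0l n (x : 'cV[R]_n) : dot 0 x = 0.
Proof. by rewrite -(scale0r (0 : 'cV_n)) dotZl mul0r. Qed.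

Lemma dot_ge0 n (x : 'cV[R]_n) : 0 <= dot x x.
Proof. by apply: sumr_ge0 => i _; rewrite -expr2 sqr_ge0. Qed.

Lemma dot_mulmx n m (A : 'M[R]_(m, n)) x y :
  dot (A *m x) y = dot x (A^T *m y).
Proof.
have dotM k (u v : 'cV[R]_k) : dot u v = (u^T *m v) 0 0.
  by rewrite mxE; apply: eq_bigr => i _; rewrite !mxE.
by rewrite !dotM trmx_mul mulmxA.
Qed.

Lemma enorm_ge0 n (x : 'cV[R]_n) : 0 <= enorm x.
Proof. exact: sqrtr_ge0. Qed.

Lemma sqr_enorm n (x : 'cV[R]_n) : enorm x ^+ 2 = dot x x.
Proof. by rewrite sqr_sqrtr // dot_ge0. Qed.

Lemma enorm0 n : enorm (0 : 'cV[R]_n) = 0.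
Proof. by rewrite /enorm dot0l sqrtr0. Qed.

Lemma enorm_gt0 n (x : 'cV[R]_n) : (0 < enorm x) = (x != 0).
Proof.
rewrite lt_def enorm_ge0 andbT; congr (~~ _); apply/eqP/eqP => [|->]; last first.
  exact: enorm0.
move=> x0; have : dot x x = 0 by rewrite -sqr_enorm x0 expr0n.
move=> /psumr_eq0P xx; apply/matrixP => i j; rewrite ord1 mxE.
apply/eqP; rewrite -(sqrf_eq0 (x i 0)) expr2; apply/eqP; apply: xx => //.
by move=> k _; rewrite -expr2 sqr_ge0.
Qed.

Lemma enormZ n (a : R) (x : 'cV[R]_n) : enorm (a *: x) = `|a| * enorm x.
Proof.
by rewrite /enorm !dotE mulrA -expr2 sqrtrM ?sqr_ge0 // sqrtr_sqr.
Qed.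

Lemma enormN n (x : 'cV[R]_n) : enorm (- x) = enorm x.
Proof. by rewrite -scaleN1r enormZ normrN1 mul1r. Qed.

Lemma enormB n (x y : 'cV[R]_n) : enorm (x - y) = enorm (y - x).
Proof. by rewrite -opprB enormN. Qed.

Lemma dot_sqr_le n (x y : 'cV[R]_n) : dot x y ^+ 2 <= dot x x * dot y y.
Proof.
have [y0|y0] := eqVneq (dot y y) 0.
  have H t : 0 <= dot x x + t * dot x y.
    have := dot_ge0 (x + (t / 2) *: y); rewrite !dotE y0 (dotC y x); lra.
  have [->|xy0] := eqVneq (dot x y) 0; first by rewrite expr0n /= mulr_ge0 ?dot_ge0.
  have := H (- (dot x x + 1) / dot x y).
  by rewrite -mulrA mulVf //; lra.
have ypos : 0 < dot y y by rewrite lt_def y0 dot_ge0.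
have := dot_ge0 (dot y y *: x - dot x y *: y); rewrite !dotE (dotC y x).
set a := dot x x; set b := dot y y; set c := dot x y => h.
have : 0 <= b * (a * b - c ^+ 2) by move: h; rewrite expr2; lra.
by rewrite pmulr_rge0 // subr_ge0.
Qed.

Lemma dot_le_enorm n (x y : 'cV[R]_n) : dot x y <= enorm x * enorm y.
Proof.
apply: (le_trans (ler_norm _)); rewrite -[leLHS]sqrtr_sqr -sqrtrM ?dot_ge0 //.
by rewrite ler_sqrt ?mulr_ge0 ?dot_ge0 // dot_sqr_le.
Qed.

Lemma enormD n (x y : 'cV[R]_n) : enorm (x + y) <= enorm x + enorm y.
Proof.
rewrite -(@ler_pXn2r _ 2) ?nnegrE ?addr_ge0 ?enorm_ge0 //.
rewrite sqrrD !sqr_enorm !dotE (dotC y x).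
have := dot_le_enorm x y; lra.
Qed.

(** The topology of column vectors comes from the sup norm [`|x|]; this
    comparison makes compact sets bounded for the Euclidean norm. *)
Lemma enorm_le_norm n (x : 'cV[R]_n) : enorm x <= Num.sqrt n%:R * `|x|.
Proof.
rewrite -(ger0_norm (normr_ge0 x)) -sqrtr_sqr -sqrtrM //.
rewrite ler_sqrt ?mulr_ge0 ?sqr_ge0 //.
apply: (@le_trans _ _ (\sum_(i < n) `|x| ^+ 2)).
  apply: ler_sum => i _; rewrite -expr2 -real_normK ?num_real //.
  rewrite ler_pXn2r ?nnegrE //.
  rewrite [leRHS]/Num.Def.normr /= mx_normrE.
  exact: (le_bigmax _ (fun ij => `|x ij.1 ij.2|) (i, 0)).
by rewrite sumr_const card_ord mulr_natl.
Qed.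

Lemma enorm_mulmx_le_ex n m (A : 'M[R]_(m, n)) :
  exists C : R, forall x, enorm (A *m x) <= C * enorm x.
Proof.
exists (Num.sqrt (\sum_i dot (row i A)^T (row i A)^T)) => x.
have s0 : 0 <= \sum_i dot (row i A)^T (row i A)^T.
  by apply: sumr_ge0 => i _; exact: dot_ge0.
rewrite /enorm -sqrtrM // ler_sqrt ?mulr_ge0 ?dot_ge0 //.
rewrite [leLHS]/dot mulr_suml; apply: ler_sum => i _.
rewrite (_ : (A *m x) i 0 = dot (row i A)^T x); first by rewrite -expr2 dot_sqr_le.
by rewrite mxE; apply: eq_bigr => j _; rewrite !mxE.
Qed.

(** Without this bound the supremum that defines [opnorm] would be
    meaningless. *)
Lemma has_ubound_opnorm n m (A : 'M[R]_(m, n)) :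
  has_ubound [set enorm (A *m x) | x in [set x : 'cV[R]_n | enorm x <= 1]].
Proof.
have [C HC] := enorm_mulmx_le_ex A.
exists `|C| => _ [x /= x1 <-]; apply: (le_trans (HC x)).
rewrite -[leRHS]mulr1 (le_trans (ler_norm _)) // normrM ler_wpM2l //.
by rewrite ger0_norm // enorm_ge0.
Qed.

Lemma enorm_mulmx n m (A : 'M[R]_(m, n)) x :
  enorm (A *m x) <= opnorm A * enorm x.
Proof.
have [x0|x0] := eqVneq (enorm x) 0.
  have [C /(_ x)] := enorm_mulmx_le_ex A.
  by rewrite x0 !mulr0.
have xpos : 0 < enorm x by rewrite lt_def x0 enorm_ge0.
rewrite -ler_pdivrMr //.
apply: (ub_le_sup (has_ubound_opnorm A)) => /=.
exists ((enorm x)^-1 *: x) => /=.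
  by rewrite enormZ ger0_norm ?invr_ge0 ?enorm_ge0 // mulVf.
by rewrite -scalemxAr enormZ ger0_norm ?invr_ge0 ?enorm_ge0 // mulrC.
Qed.

Lemma opnorm_ge0 n m (A : 'M[R]_(m, n)) : 0 <= opnorm A.
Proof.
apply: (ub_le_sup (has_ubound_opnorm A)) => /=.
by exists 0; rewrite /= ?mulmx0 enorm0.
Qed.

(** [|A^T y|^2 = <y, A A^T y> <= |y| |A| |A^T y|], so the adjoint has
    the same bound without any duality for operator norms. *)
Lemma enorm_trmulmx n m (A : 'M[R]_(m, n)) y :
  enorm (A^T *m y) <= opnorm A * enorm y.
Proof.
have [->|y0] := eqVneq (enorm (A^T *m y)) 0.
  by rewrite mulr_ge0 ?opnorm_ge0 ?enorm_ge0.
have ypos : 0 < enorm (A^T *m y) by rewrite lt_def y0 enorm_ge0.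
rewrite -(ler_pM2r ypos) -expr2 sqr_enorm -dot_mulmx.
apply: (le_trans (dot_le_enorm _ _)).
by rewrite mulrAC ler_wpM2r ?enorm_ge0 // enorm_mulmx.
Qed.

Lemma has_ubound_diameter n (S : set 'cV[R]_n) :
  compact S -> has_ubound [set enorm (x - y) | x in S & y in S].
Proof.
move=> /compact_bounded/ex_strict_bound_gt0[k k0 /= Sk].
exists (Num.sqrt n%:R * (k + k)) => _ [x Sx [y Sy <-]].
apply: (le_trans (enorm_le_norm _)); rewrite ler_wpM2l ?sqrtr_ge0 //.
by rewrite (le_trans (ler_normB _ _)) // lerD // ltW // Sk.
Qed.

Lemma enorm_le_diameter n (S : set 'cV[R]_n) x y :
  compact S -> S x -> S y -> enorm (x - y) <= diameter S.
Proof.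
move=> cS Sx Sy; apply: (ub_le_sup (has_ubound_diameter cS)).
by exists x => //; exists y.
Qed.

Lemma diameter_ge0 n (S : set 'cV[R]_n) : compact S -> S !=set0 -> 0 <= diameter S.
Proof.
by move=> cS [x Sx]; rewrite -(enorm0 n) -(subrr x); exact: enorm_le_diameter.
Qed.

End InnerProduct.
(** * Gradients *)

Section Gradients.
Context {R : realType} {n : nat}.
Local Notation E := 'cV[R]_n.
Implicit Types (f g : E -> R) (x y v : E).

(** Differentiability enters only through restrictions to lines, hence this
    directional form, which is stable under adding a quadratic function. *)
Definition has_gradient f : Prop :=
  forall x v, is_derive x v f (dot (grad f x) v).

Lemma differentiable_has_gradient f :
  (forall x, differentiable f x) -> has_gradient f.
Proof.
move=> df x v; split; first exact: diff_derivable.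
rewrite deriveE // [v in LHS]matrix_sum_delta.
under eq_bigr do rewrite big_ord1.
rewrite linear_sum; apply: eq_bigr => i _.
by rewrite linearZ mxE deriveE // mulrC.
Qed.

Lemma gradE f (g : E) x :
  (forall v, is_derive x v f (dot g v)) -> grad f x = g.
Proof.
move=> df; apply/matrixP => i j; rewrite ord1 mxE.
have [_ ->] := df (delta_mx i 0).
rewrite /dot (bigD1 i) //= big1 => [|k ki]; last by rewrite mxE (negbTE ki) mulr0.
by rewrite mxE !eqxx mulr1 addr0.
Qed.

Lemma is_derive_quadratic f x v (b c : R) :
  (forall t, f (t *: v + x) = f x + t * b + t ^+ 2 * c) -> is_derive x v f b.
Proof.
move=> fE.
have cv : (fun t : R => t^-1 *: ((f \o shift x) (t *: v) - f x)) @ 0^' --> b.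
  have H : (fun t : R => b + t * c) @ 0^' --> b.
    rewrite -[X in _ --> X]addr0; apply: cvgD; first exact: cvg_cst.
    by rewrite -[X in _ --> X](mul0r c); apply: cvgMr_tmp => P /nbhs_dnbhs.
  apply: cvg_trans H; apply: near_eq_cvg.
  near=> t; rewrite /= fE /GRing.scale /=.
  have t0 : t != 0 by near: t; exact: nbhs_dnbhs_neq.
  by field.
by split; [apply/cvg_ex; exists b | apply: cvg_lim].
Unshelve. all: by end_near. Qed.

Lemma is_derive_line f x v (t : R) (d : R) :
  is_derive (t *: v + x) v f d ->
  is_derive t (1 : R) (fun t => f (t *: v + x)) d.
Proof.
move=> [df dE].
have E : (fun h : R => h^-1 *: (((fun t : R => f (t *: v + x)) \o shift t) (h *: 1) - f (t *: v + x)))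
   = (fun h => h^-1 *: ((f \o shift (t *: v + x)) (h *: v) - f (t *: v + x))).
  apply/funext => h; congr (_ *: (f _ - _)).
  by rewrite /= [h *: 1]mulr1 scalerDl addrA.
by split; rewrite /derivable /derive E.
Qed.

(** The mean value theorem for the restriction of [f] to the segment. *)
Lemma mean_value_grad f x y : has_gradient f ->
  exists2 t, 0 <= t <= 1 &
    f y - f x = dot (grad f (t *: (y - x) + x)) (y - x).
Proof.
move=> df.
pose phi t := f (t *: (y - x) + x).
have dphi (t : R) : is_derive t (1 : R) phi (dot (grad f (t *: (y - x) + x)) (y - x)).
  by apply: is_derive_line.
have [|t t01] := @MVT_segment R phi _ 0 1 ler01 (fun t _ => dphi t).
  apply: derivable_within_continuous => t _; exact: ex_derive.
rewrite subr0 mulr1 /phi scale1r scale0r add0r subrK => e.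
by exists t; rewrite // -in_itv.
Qed.

(** The mean value theorem gives the constant [L] here instead of the sharp
    [L / 2], which is enough to bound the number of backtracking steps. *)
Lemma lipschitz_grad_upper (L : R) f x y : has_gradient f -> 0 <= L ->
  lipschitz_grad L f ->
  f y <= linearization f y x + L * enorm (y - x) ^+ 2.
Proof.
move=> df L0 lf; have [t /andP[t0 t1] e] := mean_value_grad x y df.
rewrite /linearization -lerBlDl opprD addrA e -dotNl -dotDl.
apply: (le_trans (dot_le_enorm _ _)).
rewrite expr2 mulrA ler_wpM2r ?enorm_ge0 //; apply: (le_trans (lf _ _)).
by rewrite addrK enormZ ger0_norm // ler_wpM2l // ler_piMl // enorm_ge0.
Qed.

(** Convexity bounds the difference quotients of [f] at [x] in the direction
    [u - x] by [f u - f x], and the gradient is their limit. *)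
Lemma convex_grad_lower f x u : has_gradient f ->
  convex_function [set: E] f -> linearization f u x <= f u.
Proof.
move=> df cf; rewrite /linearization -lerBrDl leNgt; apply/negP => lt.
have [ + dE] := df x (u - x); rewrite /derivable -/(derive f x (u - x)) dE.
move=> /cvgrPdist_lt /(_ (dot (grad f x) (u - x) - (f u - f x))).
rewrite subr_gt0 => /(_ lt) /nbhs_ballP[r /= r0 Pr].
(* a step that is within the radius [r] of the limit, and at most 1 *)
pose h := Num.min (r / 2) 1.
have h0 : 0 < h by rewrite lt_min divr_gt0 //= ltr01.
have h1 : h <= 1 by rewrite ge_min lexx orbT.
have := Pr h; rewrite /ball /= sub0r normrN gtr0_norm // gt_min.
rewrite (_ : r / 2 < r) /=; last by lra.
move=> /(_ isT); rewrite gt_eqF // => /(_ isT) /ltr_normlW.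
apply/negP; rewrite -leNgt.
rewrite lerB // /GRing.scale /= mulrC ler_pdivrMr //.
have := cf (Itv01 (ltW h0) h1) u x; rewrite !inE => /(_ I I).
rewrite convRE /= /conv /= => cvx.
have -> : h *: (u - x) + x = h *: u + (1 - h) *: x.
  by rewrite scalerBl scale1r scalerBr addrAC addrA.
rewrite lerBlDl (le_trans cvx) // /unstable.onem; lra.
Qed.

End Gradients.
(** * Closed convex functions with compact domain *)

(** The first-order coefficient decides near 0. *)
Lemma le0_quadratic {R : realType} (a b : R) :
  (forall t, 0 < t < 1 -> 0 <= t * a + t ^+ 2 * b) -> 0 <= a.
Proof.
move=> H; rewrite leNgt; apply/negP => a0.
(* here [t |b| < - a], so the linear term wins *)
pose t := - a / (`|b| - a + `|b| - a).
have b0 : 0 <= `|b| := normr_ge0 b.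
have den0 : 0 < `|b| - a + `|b| - a by lra.
have t0 : 0 < t by rewrite divr_gt0 //; lra.
have t1 : t < 1 by rewrite ltr_pdivrMr //; lra.
have := H t; rewrite t0 t1 => /(_ isT).
rewrite expr2 -mulrA -mulrDr pmulr_rge0 //; apply/negP; rewrite -ltNge.
have : t * b <= t * `|b| by rewrite ler_wpM2l ?ler_norm // ltW.
have : t * (`|b| - a + `|b| - a) = - a by rewrite divfK // gt_eqF.
have : t * a < 0 by rewrite pmulr_rlt0.
lra.
Qed.

Section ConvexExtended.
Context {R : realType} {n : nat}.
Local Notation E := 'cV[R]_n.
Context (h : E -> \bar R).
Hypothesis h_proper : Defs.proper h.
Implicit Types (x y u w g : E).

Lemma edom_fineE x : edom h x -> h x = (fine (h x))%:E.
Proof.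
by move=> hx; rewrite fineK // fin_numElt hx andbT ltNye (proj1 h_proper).
Qed.

Lemma nedomE x : ~ edom h x -> h x = +oo%E.
Proof. by rewrite /edom /= => /negP; rewrite -leNgt leye_eq => /eqP. Qed.

Lemma subdiffP x g : edom h x ->
  subdiff h x g <->
  forall u, edom h u -> fine (h x) + dot g (u - x) <= fine (h u).
Proof.
move=> hx; split=> [sub u hu|sub u].
  by have := sub u; rewrite (edom_fineE hx) (edom_fineE hu) -EFinD lee_fin.
have [hu|hu] := pselect (edom h u); last by rewrite (nedomE hu) leey.
by rewrite (edom_fineE hx) (edom_fineE hu) -EFinD lee_fin sub.
Qed.

Hypothesis h_convex : econvex h.

Lemma econvex_fine x y (t : R) : edom h x -> edom h y -> 0 < t < 1 ->
  edom h (t *: x + (1 - t) *: y) /\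
  fine (h (t *: x + (1 - t) *: y)) <= t * fine (h x) + (1 - t) * fine (h y).
Proof.
move=> hx hy t01; have := h_convex x y t01.
rewrite (edom_fineE hx) (edom_fineE hy) -!EFinM -EFinD => le.
have hxy : edom h (t *: x + (1 - t) *: y) by apply: (le_lt_trans le); rewrite ltry.
by split => //; move: le; rewrite (edom_fineE hxy) lee_fin.
Qed.

Lemma is_proxP (L : R) w y : 0 < L -> is_prox L^-1 h w y <->
  edom h y /\ forall u, edom h u ->
    fine (h y) + L / 2 * enorm (y - w) ^+ 2
      <= fine (h u) + L / 2 * enorm (u - w) ^+ 2.
Proof.
move=> L0; have Li : 0 < L^-1 by rewrite invr_gt0.
have scale (a b c d : R) :
    (L^-1 * a + b / 2 <= L^-1 * c + d / 2) = (a + L / 2 * b <= c + L / 2 * d).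
  rewrite -[RHS](ler_pM2l Li) !mulrDr !mulrA mulVf ?gt_eqF //.
  by rewrite !mul1r !(mulrC 2^-1).
split=> [prox|[hy min] u].
  have [x0 hx0] := proj2 h_proper.
  have hy : edom h y.
    rewrite /edom /= ltNge leye_eq; apply/eqP => hy.
    by have := prox x0; rewrite hy (edom_fineE hx0) gt0_muley ?lte_fin // addye //.
  split => // u hu; have := prox u.
  by rewrite (edom_fineE hy) (edom_fineE hu) -!EFinM -!EFinD lee_fin scale.
have [hu|hu] := pselect (edom h u).
  by rewrite (edom_fineE hy) (edom_fineE hu) -!EFinM -!EFinD lee_fin scale min.
by rewrite (nedomE hu) gt0_muley ?lte_fin // addye // leey.
Qed.

(** Compare the minimizer [y] with the points [y + t (u - y)] and let [t]
    go to 0: the first-order terms give the variational inequality. *)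
Lemma is_prox_subgradient (L : R) w y u : 0 < L -> is_prox L^-1 h w y ->
  edom h u -> fine (h y) + L * dot (w - y) (u - y) <= fine (h u).
Proof.
move=> L0 /(is_proxP _ _ L0)[hy min] hu; rewrite -subr_ge0.
apply: (@le0_quadratic _ _ (L / 2 * enorm (u - y) ^+ 2)) => t t01.
have [hv cv] := econvex_fine hu hy t01.
have := min _ hv; rewrite !sqr_enorm.
have -> : t *: u + (1 - t) *: y - w = t *: (u - y) - (w - y).
  by apply/matrixP => i j; rewrite !mxE; ring.
rewrite !dotE (dotC y u) (dotC y w) (dotC w u) => le.
rewrite expr2; move: cv le; lra.
Qed.

Hypothesis h_closed : lower_semicontinuous h.
Hypothesis h_compact : compact (edom h).

(** The sublevel sets of [h + g] form a filter base on the compact domain, and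
    lower semicontinuity makes every cluster point a minimizer. *)
Lemma exists_minimizer (g : E -> R) : continuous g ->
  exists2 y, edom h y &
    forall u, edom h u -> fine (h y) + g y <= fine (h u) + g u.
Proof.
move=> cg; pose phi x := fine (h x) + g x.
pose B u := [set x | edom h x /\ phi x <= phi u].
have FB : ProperFilter (filter_from (edom h) B).
  apply: filter_from_proper; last by move=> u hu; exists u; split.
  apply: filter_from_filter; first exact: (proj2 h_proper).
  move=> u v hu hv; have [uv|vu] := leP (phi u) (phi v).
    by exists u => // x [hx xu]; split; split => //; exact: le_trans uv.
  by exists v => // x [hx xv]; split; split => //; exact: le_trans (ltW vu).
have [|x [hx clx]] := h_compact FB.
  by have [u hu] := proj2 h_proper; exists u => // x [].
exists x => // u hu; rewrite -/(phi x) -/(phi u) leNgt; apply/negP => lt.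
pose d := (phi x - phi u) / 2.
have d0 : 0 < d by rewrite divr_gt0 // subr_gt0.
have [|V xV Vh] := h_closed (x := x) (a := fine (h x) - d).
  by rewrite [ltRHS](edom_fineE hx) lte_fin gtrBl.
have xW : nbhs x [set y | g x - d < g y].
  have /cvgrPdist_lt /(_ d d0) := cg x.
  by apply: filterS => y /= /ltr_normlW; rewrite ltrBlDr ltrBlDl addrC.
have [y [[hy yu] [Vy Wy]]] := clx _ _ (ex_intro2 _ _ u hu (@subset_refl _ _)) (filterI xV xW).
have := Vh y Vy; rewrite (edom_fineE hy) lte_fin => hlt.
move: yu Wy hlt; rewrite /phi /d /phi /=; lra.
Qed.

Lemma continuous_sqr_enorm (a : R) w : continuous (fun x => a * enorm (x - w) ^+ 2).
Proof.
have -> : (fun x => a * enorm (x - w) ^+ 2) =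
    (fun x => a * \sum_i (x i 0 - w i 0) * (x i 0 - w i 0)).
  apply/funext => z; congr (_ * _); rewrite sqr_enorm.
  by apply: eq_bigr => i _; rewrite !mxE.
suff c : continuous (fun x => \sum_i (x i 0 - w i 0) * (x i 0 - w i 0)).
  by move=> x; apply: (@cvgMl_tmp _ _ (nbhs x)); exact: c.
apply: continuous_big => [|i _ z]; first exact: add_continuous.
have c : (fun x : E => x i 0 - w i 0) @ z --> z i 0 - w i 0.
  by apply: (@cvgB _ _ _ (nbhs z)); (exact: cvg_cst || exact: coord_continuous).
exact: (cvgM c c).
Qed.

Lemma exists_prox (L : R) w : 0 < L -> exists y, is_prox L^-1 h w y.
Proof.
move=> L0; have [y hy min] := exists_minimizer (@continuous_sqr_enorm (L / 2) w).
by exists y; apply/is_proxP.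
Qed.

End ConvexExtended.
(** * One accelerated gradient step *)

Section EstimateSequence.
Context {R : realType} {n : nat}.
Local Notation E := 'cV[R]_n.

(** The quadratic in [u] on the right-hand side has its
    minimizer at [xp].  With [d = xt - y], [X = x - y], the two sides differ by
    [A mu / 4 |y0 - y|^2 + a mu / (4 tau tau') |a L d - tau X|^2],
    where [tau' = tau + a mu / 2]. *)
Lemma estimate_sequence_step (A a tau L mu : R) (x y0 y xt xp u : E) :
    0 <= A -> 0 < a -> 0 < tau -> 0 <= mu -> L * a ^+ 2 = tau * (A + a) ->
    (A + a) *: xt = A *: y0 + a *: x ->
    (tau + a * mu / 2) *: xp
      = (mu * a / 2) *: y + tau *: x - a *: (L *: (xt - y)) ->
  (tau + a * mu / 2) / 2 * enorm (u - xp) ^+ 2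
    + (A + a) * L / 2 * enorm (y - xt) ^+ 2
  <= A * (dot (L *: (xt - y)) (y0 - y) + mu / 4 * enorm (y0 - y) ^+ 2)
     + a * (dot (L *: (xt - y)) (u - y) + mu / 4 * enorm (u - y) ^+ 2)
     + tau / 2 * enorm (u - x) ^+ 2.
Proof.
move=> A0 a0 tau0 mu0 La xtE xpE.
pose d := xt - y; pose X := x - y; pose Y := y0 - y; pose w := u - y.
pose tau' := tau + a * mu / 2.
have amu : 0 <= a * mu / 2 by rewrite divr_ge0 // mulr_ge0 // ltW.
have tau'0 : 0 < tau' by rewrite /tau' ltr_wpDr.
have AY : A *: Y = (A + a) *: d - a *: X.
  apply/matrixP => i j; have /matrixP/(_ i j) := xtE.
  rewrite /Y /d /X !mxE; lra.
have uxpE : u - xp = w - tau'^-1 *: (tau *: X - (a * L) *: d).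
  have tau'n : tau' != 0 by rewrite gt_eqF.
  apply/matrixP => i j; have /matrixP/(_ i j) := xpE.
  rewrite -/tau' /w /X /d !mxE => e; apply: (mulfI tau'n).
  by rewrite [RHS]mulrBr mulVKf // mulrBr e /tau'; ring.
rewrite uxpE (_ : u - x = w - X); last by rewrite /w /X opprB addrA subrK.
rewrite -[y - xt]opprB enormN -/d -/Y -/w.
have dY : A * dot d Y = (A + a) * dot d d - a * dot d X.
  by rewrite -dotZr AY dotDr dotNr !dotZr.
have AE : A = L * a ^+ 2 / tau - a by rewrite La mulrAC divff ?gt_eqF // mul1r addrK.
clearbody d X Y w.
rewrite -subr_ge0.
have -> : A * (dot (L *: d) Y + mu / 4 * enorm Y ^+ 2) +
   a * (dot (L *: d) w + mu / 4 * enorm w ^+ 2) + tau / 2 * enorm (w - X) ^+ 2 -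
   (tau' / 2 * enorm (w - tau'^-1 *: (tau *: X - (a * L) *: d)) ^+ 2 +
    (A + a) * L / 2 * enorm d ^+ 2) =
   A * mu / 4 * enorm Y ^+ 2 +
   a * mu / 4 / tau / tau' * enorm ((a * L) *: d - tau *: X) ^+ 2.
  rewrite mulrDr dotZl mulrCA dY !sqr_enorm !dotE.
  rewrite (dotC X d) (dotC w d) (dotC w X) AE /tau'.
  have den0 : 0 < tau * 2 + a * mu by move: tau'0; rewrite /tau'; lra.
  by field; rewrite !gt_eqF.
by rewrite addr_ge0 // mulr_ge0 ?sqr_ge0 // ?divr_ge0 ?mulr_ge0 // ltW.
Qed.

End EstimateSequence.
(** * The restarted method on one subproblem *)

Section Subproblem.
Context {R : realType} {n : nat}.
Local Notation E := 'cV[R]_n.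
Context (chi M0 eps mubar Lf : R) (f : E -> R) (h : E -> \bar R).
Hypothesis chi01 : 0 < chi < 1.
Hypothesis f_lower : forall u x, linearization f u x <= f u.
Hypothesis f_upper : forall y x,
  f y <= linearization f y x + Lf * enorm (y - x) ^+ 2.
Hypothesis f_lipschitz : lipschitz_grad Lf f.
Hypothesis h_proper : Defs.proper h.
Hypothesis h_convex : econvex h.
Hypothesis h_closed : lower_semicontinuous h.
Hypothesis h_compact : compact (edom h).
Hypothesis mubar_gt0 : 0 < mubar.
Hypothesis M0_gt0 : 0 < M0.
Local Notation phi u := (f u + fine (h u)).
Hypothesis phi_strong : forall x y, edom h x -> edom h y ->
  phi (2^-1 *: x + (1 - 2^-1) *: y)
    <= phi x / 2 + phi y / 2 - mubar / 8 * enorm (x - y) ^+ 2.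
Implicit Types (s : fista_state R n) (x y u : E).

(** ** A single iteration *)

Record cycle_wf s : Prop := CycleWf {
  wf_mu : 0 < fs_mu s;
  wf_x0 : edom h (fs_x0 s);
  wf_y : edom h (fs_y s);
  wf_A : 0 <= fs_A s;
  wf_tau : fs_tau s = 1 + fs_mu s * fs_A s / 2;
  wf_L : M0 <= fs_L s }.

Lemma wf_L_gt0 s : cycle_wf s -> 0 < fs_L s.
Proof. by move=> /wf_L; exact: lt_le_trans. Qed.

Lemma wf_tau_ge1 s : cycle_wf s -> 1 <= fs_tau s.
Proof.
move=> wf; rewrite (wf_tau wf) lerDl divr_ge0 //.
by rewrite mulr_ge0 ?(wf_A wf) // ltW // (wf_mu wf).
Qed.

Lemma fs_aE s : cycle_wf s ->
  0 < fs_a s /\ fs_L s * fs_a s ^+ 2 = fs_tau s * (fs_A s + fs_a s).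
Proof.
move=> wf; have L0 := wf_L_gt0 wf; have A0 := wf_A wf.
have tau0 : 0 < fs_tau s by apply: lt_le_trans (wf_tau_ge1 wf).
set rad := fs_tau s ^+ 2 + 4 * fs_tau s * fs_A s * fs_L s.
have rad0 : 0 <= rad.
  by rewrite addr_ge0 ?sqr_ge0 // !mulr_ge0 // ltW.
have a0 : 0 < fs_a s.
  rewrite /fs_a divr_gt0 ?mulr_gt0 //.
  by rewrite ltr_pwDl ?sqrtr_ge0.
split => //.
have e : 2 * fs_L s * fs_a s - fs_tau s = Num.sqrt rad.
  by rewrite /fs_a -/rad mulrC divfK ?gt_eqF ?mulr_gt0 // addrAC subrr add0r.
have : (2 * fs_L s * fs_a s - fs_tau s) ^+ 2 = rad by rewrite e sqr_sqrtr.
rewrite /rad; set L := fs_L s; set a := fs_a s; set t := fs_tau s; set A := fs_A s.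
move=> e2; apply: (@mulfI _ (4 * L)); first by rewrite mulf_neq0 // gt_eqF.
have : 4 * L * (L * a ^+ 2) = (2 * L * a - t) ^+ 2 + 4 * L * a * t - t ^+ 2 by ring.
by rewrite e2 => ->; ring.
Qed.

Lemma trial_subgradient s y u : 0 < fs_L s -> trial_point f h s y -> edom h u ->
  fine (h y) + dot (fs_s s y - grad f (fs_xtilde s)) (u - y) <= fine (h u).
Proof.
move=> L0 tr hu.
have := is_prox_subgradient h_proper h_convex L0 tr hu.
rewrite -dotZl addrAC scalerBr scalerA divff ?gt_eqF // scale1r.
by [].
Qed.

Lemma trial_edom s y : 0 < fs_L s -> trial_point f h s y -> edom h y.
Proof. by move=> L0 /(is_proxP h_proper _ _ L0)[]. Qed.

(** Acceptance of [y] bounds the error of the linearization, so that the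
    scaled step [s] is an approximate subgradient of the whole objective. *)
Lemma trial_eps_subgradient s y u : 0 < fs_L s -> trial_point f h s y ->
    ~ trial_fails chi f s y -> edom h u ->
  phi y - (1 - chi) * fs_L s / 4 * enorm (y - fs_xtilde s) ^+ 2
    + dot (fs_s s y) (u - y) <= phi u.
Proof.
move=> L0 tr /negP; rewrite -leNgt => acc hu.
have := trial_subgradient L0 tr hu; have := f_lower u (fs_xtilde s).
move: acc; rewrite /linearization.
set g := grad f _; set X := fs_xtilde s; set S := fs_s s y; clearbody S X g.
rewrite !dotE; lra.
Qed.

(** Strong convexity at the midpoint of [u] and [y], together with
    [trial_eps_subgradient] at that midpoint, gains a quadratic term at the
    price of half of the modulus and twice the error; this is the reason for the
    factors 1/2 of [mu] and 1/4 of [L] in the method. *)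
Lemma trial_quadratic_lower s y u : 0 < fs_L s -> trial_point f h s y ->
    ~ trial_fails chi f s y -> edom h u -> fs_mu s <= mubar ->
  phi y - (1 - chi) * fs_L s / 2 * enorm (y - fs_xtilde s) ^+ 2
    + (dot (fs_s s y) (u - y) + fs_mu s / 4 * enorm (u - y) ^+ 2) <= phi u.
Proof.
move=> L0 tr acc hu mu_le.
have hy := trial_edom L0 tr.
have half01 : 0 < (2^-1 : R) < 1 by lra.
have [hm _] := econvex_fine h_proper h_convex hu hy half01.
have := trial_eps_subgradient L0 tr acc hm; have := phi_strong hu hy.
have -> : 2^-1 *: u + (1 - 2^-1) *: y - y = 2^-1 *: (u - y).
  by apply/matrixP => i j; rewrite !mxE; field.
rewrite dotZr.
have : fs_mu s * enorm (u - y) ^+ 2 <= mubar * enorm (u - y) ^+ 2.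
  by rewrite ler_wpM2r ?sqr_ge0.
lra.
Qed.

(** The estimate-sequence inequality of accelerated gradient methods. *)
Definition estimate s : Prop := forall u, edom h u ->
  fs_A s * phi (fs_y s) + fs_tau s / 2 * enorm (u - fs_x s) ^+ 2
    <= fs_A s * phi u + enorm (u - fs_x0 s) ^+ 2 / 2.

Lemma estimate_start (mu M : R) x : estimate (cycle_start mu M x).
Proof. by move=> u hu; rewrite /= !mul0r !add0r mul1r mulrC. Qed.

(** Use the lower bound of [trial_quadratic_lower] at the previous [y] with
    weight [A] and at [u] with weight [a]; what remains is
    [estimate_sequence_step]. *)
Lemma estimate_next s y : cycle_wf s -> trial_point f h s y ->
    ~ trial_fails chi f s y -> fs_mu s <= mubar -> estimate s ->
  forall u, edom h u ->
  fs_nextA s * phi y + fs_nexttau s / 2 * enorm (u - fs_nextx s y) ^+ 2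
    + chi / 2 * fs_nextA s * fs_L s * enorm (y - fs_xtilde s) ^+ 2
  <= fs_nextA s * phi u + enorm (u - fs_x0 s) ^+ 2 / 2.
Proof.
move=> wf tr acc mu_le est u hu.
have L0 := wf_L_gt0 wf; have [a0 La] := fs_aE wf.
have tau0 : 0 < fs_tau s by apply: lt_le_trans (wf_tau_ge1 wf).
have A0 := wf_A wf; have mu0 := ltW (wf_mu wf).
have A'0 : 0 < fs_A s + fs_a s by rewrite ltr_wpDl.
have tau'0 : 0 < fs_nexttau s.
  by rewrite /fs_nexttau ltr_wpDr // divr_ge0 // mulr_ge0 // ltW.
have xtE : (fs_A s + fs_a s) *: fs_xtilde s = fs_A s *: fs_y s + fs_a s *: fs_x s.
  rewrite /fs_xtilde scalerA.
  by rewrite divff ?gt_eqF // scale1r.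
have xpE : (fs_tau s + fs_a s * fs_mu s / 2) *: fs_nextx s y =
    (fs_mu s * fs_a s / 2) *: y + fs_tau s *: fs_x s
    - fs_a s *: (fs_L s *: (fs_xtilde s - y)).
  by rewrite /fs_nextx -/(fs_nexttau s) [LHS]scalerA divff ?gt_eqF // scale1r.
have alg := estimate_sequence_step u A0 a0 tau0 mu0 La xtE xpE.
have lo_y := trial_quadratic_lower L0 tr acc (wf_y wf) mu_le.
have lo_u := trial_quadratic_lower L0 tr acc hu mu_le.
have est_u := est u hu.
have := ler_wpM2l A0 lo_y; have := ler_wpM2l (ltW a0) lo_u.
move: alg est_u; rewrite /fs_s /fs_nextA -/(fs_nexttau s).
lra.
Qed.

(** Evaluating the estimate at [y] itself cancels the objective, and what is
    left is the test; so a cycle is abandoned only if its modulus exceeds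
    the true one. *)
Lemma estimate_cycle_test s y : cycle_wf s -> trial_point f h s y ->
    ~ trial_fails chi f s y -> fs_mu s <= mubar -> estimate s ->
  cycle_test chi s y.
Proof.
move=> wf tr acc mu_le est.
have hy := trial_edom (wf_L_gt0 wf) tr.
have := estimate_next wf tr acc mu_le est hy.
have : 0 <= fs_nexttau s / 2 * enorm (y - fs_nextx s y) ^+ 2.
  rewrite mulr_ge0 ?sqr_ge0 // divr_ge0 // addr_ge0 //.
    exact: le_trans (wf_tau_ge1 wf).
  rewrite divr_ge0 // mulr_ge0 //; apply: ltW; last exact: wf_mu.
  by have [] := fs_aE wf.
rewrite /cycle_test; lra.
Qed.

Lemma double_wf s : cycle_wf s -> cycle_wf (double_L s).
Proof.
case=> mu0 hx0 hy A0 tauE LM; split => //=.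
by apply: (le_trans LM); rewrite ler_peMl // ?ler1n // (le_trans (ltW M0_gt0)).
Qed.

Lemma start_wf mu M x : 0 < mu -> M0 <= M -> edom h x ->
  cycle_wf (cycle_start mu M x).
Proof. by move=> mu0 MM hx; split => //=; rewrite mulr0 mul0r addr0. Qed.

Lemma next_wf s y : cycle_wf s -> trial_point f h s y -> cycle_wf (fs_next s y).
Proof.
move=> wf tr; have [a0 _] := fs_aE wf.
have hy := trial_edom (wf_L_gt0 wf) tr.
case: wf => mu0 hx0 _ A0 tauE LM; split => //=.
  by rewrite addr_ge0 // ltW.
by rewrite /fs_nexttau /fs_nextA tauE; ring.
Qed.

(** ** Existence of a next step *)

Lemma rfista_progress s : cycle_wf s ->
  exists k o, rfista_step chi M0 eps f h s k o.
Proof.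
move=> wf; have L0 := wf_L_gt0 wf.
have [y tr] : exists y, trial_point f h s y by exact: exists_prox.
have [fail|acc] := pselect (trial_fails chi f s y).
  by exists 1%N, (inl (double_L s)); exact: RFistaDouble fail.
have [test|restart] := pselect (cycle_test chi s y); last first.
  (* the final [L] of a cycle is always admissible for the next one *)
  exists 2%N, (inl (cycle_start (fs_mu s / 2) (fs_L s) (fs_x0 s))).
  apply: RFistaRestart tr acc restart _ (wf_x0 wf).
  rewrite lexx andbT ge_max (wf_L wf) andbT; lra.
have [stop|next] := leP (enorm (fs_v f s y)) eps.
  by exists 2%N, (inr (y, fs_v f s y)); exact: RFistaStop.
by exists 2%N, (inl (fs_next s y)); exact: RFistaNext.
Qed.

(** ** Counting gradient evaluations *)

Hypothesis Lf_gt0 : 0 < Lf.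
Hypothesis M0_le : M0 <= 2 * Lf.
Hypothesis eps_ge0 : 0 <= eps.
Hypothesis eps_gt0 : 0 < diameter (edom h) -> 0 < eps.
Context (mu0 : R).
Hypothesis mu0_ge : mubar <= mu0.

(** [L] is doubled only while [(1 - chi) L / 4 < Lf]. *)
Definition step_max : R := 8 * Lf / (1 - chi).
Definition growth_rate : R := Num.sqrt (mubar / (4 * step_max)).
(** The solution [J] of [chi eps^2 (1 + q)^(J - 1) = (2 step_max D)^2], with
    [q] the growth rate.  If [D = 0], then [eps] may be 0, and the conventions
    [x / 0 = 0] and [ln 0 = 0] give the value 1. *)
Definition iteration_max : R :=
  1 + Num.max (ln ((2 * step_max * diameter (edom h)) ^+ 2 / (chi * eps ^+ 2))) 0
      / ln (1 + growth_rate).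
Definition doubling_max : R := log2 (step_max / M0).
Definition restart_max : R := (Num.ceil (log2pp (mu0 / mubar)))%:~R.
Definition cycle_cost : R := 2 * iteration_max + doubling_max + 2.
Definition run_cost : R := (restart_max + 1) * cycle_cost.

Local Notation Lmax := step_max.
Local Notation q := growth_rate.

Lemma step_max_ge : 8 * Lf <= Lmax.
Proof.
have /andP[chi0 chi1] := chi01.
rewrite /Lmax ler_pdivlMr ?subr_gt0 // ler_piMr //; last by lra.
by rewrite mulr_ge0 // ltW.
Qed.

Lemma step_max_gt0 : 0 < Lmax.
Proof. by apply: lt_le_trans step_max_ge; rewrite mulr_gt0. Qed.

Lemma growth_rate_gt0 : 0 < q.
Proof. by rewrite sqrtr_gt0 divr_gt0 // mulr_gt0 // step_max_gt0. Qed.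

Lemma growth_rate_sqr : 4 * Lmax * q ^+ 2 = mubar.
Proof.
have L0 := step_max_gt0.
rewrite sqr_sqrtr; last by rewrite ltW // divr_gt0 // mulr_gt0.
by rewrite mulrC divfK // gt_eqF // mulr_gt0.
Qed.

Lemma ln_growth_gt0 : 0 < ln (1 + q).
Proof. by apply: ln_gt0; rewrite ltrDl growth_rate_gt0. Qed.

Lemma iteration_max_ge1 : 1 <= iteration_max.
Proof.
rewrite lerDl divr_ge0 //; last exact: ltW ln_growth_gt0.
by rewrite le_max lexx orbT.
Qed.

Lemma ln2_gt0 : 0 < ln (2 : R).
Proof. by apply: ln_gt0; rewrite ltr1n. Qed.

Lemma log2_le_of_pow (k : nat) (t : R) : 2 ^+ k <= t -> k%:R <= log2 t.
Proof.
move=> le; have p0 : 0 < (2 : R) ^+ k by rewrite exprn_gt0.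
rewrite /log2 ler_pdivlMr ?ln2_gt0 // mulr_natl -lnXn //.
by rewrite ler_ln ?posrE // (lt_le_trans p0).
Qed.

Lemma doubling_max_ge0 : 0 <= doubling_max.
Proof.
apply: (@log2_le_of_pow 0); rewrite expr0 ler_pdivlMr // mul1r.
by apply: (le_trans M0_le); have := step_max_ge; have := Lf_gt0; lra.
Qed.

Lemma restart_max_ge1 : 1 <= restart_max.
Proof.
rewrite /restart_max ler1z -gtz0_ge1.
have : (1 : R) <= (Num.ceil (log2pp (mu0 / mubar)))%:~R.
  by apply: le_trans (ceil_ge _); rewrite /log2pp le_max lexx orbT.
by rewrite -(ltr0z R); exact: lt_le_trans.
Qed.

Lemma restart_le (k : nat) :
  ((0 < k)%N -> mubar < 2 * (mu0 / 2 ^+ k)) -> k%:R <= restart_max.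
Proof.
case: k => [_|k /(_ isT) lt].
  by apply: le_trans restart_max_ge1; rewrite ler01.
have p0 : 0 < (2 : R) ^+ k by rewrite exprn_gt0.
have lt2 : 2 ^+ k < mu0 / mubar.
  rewrite ltr_pdivlMr // mulrC -ltr_pdivlMr //.
  suff <- : 2 * (mu0 / 2 ^+ k.+1) = mu0 / 2 ^+ k by [].
  by rewrite exprS; field; rewrite gt_eqF.
rewrite /restart_max -[k.+1%:R]/((Posz k.+1)%:~R) ler_int.
suff : (Posz k < Num.ceil (log2pp (mu0 / mubar)))%R by [].
rewrite ceil_gt_int /log2pp lt_max; apply/orP; left.
rewrite /log2 ltr_pdivlMr ?ln2_gt0 // -[(Posz k)%:~R]/(k%:R) mulr_natl -lnXn //.
by rewrite ltr_ln ?posrE // (lt_trans p0).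
Qed.

(** Already [a >= tau / L >= 1 / L], which starts the geometric growth. *)
Lemma nextA_ge1 s : cycle_wf s -> 1 <= fs_nextA s * fs_L s.
Proof.
move=> wf; have L0 := wf_L_gt0 wf; have [a0 La] := fs_aE wf.
have tau1 := wf_tau_ge1 wf; have A0 := wf_A wf.
have : fs_tau s <= fs_a s * fs_L s.
  have : fs_a s * fs_tau s <= fs_a s * (fs_a s * fs_L s).
    rewrite mulrA -expr2 [leRHS]mulrC La mulrDr [leLHS]mulrC lerDr.
    by rewrite mulr_ge0 // (le_trans ler01).
  by rewrite ler_pM2l.
have : 0 <= fs_A s * fs_L s by rewrite mulr_ge0 // ltW.
by rewrite /fs_nextA; lra.
Qed.

(** [L a^2 = tau (A + a) >= (mu A / 2) A] bounds [a] below by a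
    fixed fraction of [A]. *)
Lemma nextA_growth s : cycle_wf s -> mubar / 2 <= fs_mu s -> fs_L s <= Lmax ->
  (1 + q) * (fs_A s * fs_L s) <= fs_nextA s * fs_L s.
Proof.
move=> wf mu_ge L_le; have L0 := wf_L_gt0 wf; have [a0 La] := fs_aE wf.
have A0 := wf_A wf; have q0 := growth_rate_gt0.
rewrite mulrA ler_pM2r // mulrDl mul1r lerD2l.
have qA0 : 0 <= q * fs_A s by rewrite mulr_ge0 // ltW.
have an : 0 <= fs_a s by rewrite ltW.
rewrite -(@ler_pXn2r _ 2) ?nnegrE // -(ler_pM2l L0) La.
have tauE := wf_tau wf.
have A2 : 0 <= fs_A s ^+ 2 := sqr_ge0 _.
have h1 : fs_L s * q ^+ 2 <= mubar / 4.
  rewrite ler_pdivlMr // -growth_rate_sqr.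
  have : fs_L s * q ^+ 2 <= Lmax * q ^+ 2 by rewrite ler_wpM2r // sqr_ge0.
  lra.
have h2 := ler_wpM2r A2 h1.
have h3 := ler_wpM2r A2 mu_ge.
have h4 : fs_mu s * fs_A s / 2 * fs_A s <= fs_tau s * (fs_A s + fs_a s).
  apply: ler_pM => //; first by rewrite divr_ge0 // mulr_ge0 // ltW // (wf_mu wf).
    by rewrite tauE lerDr.
  by rewrite lerDl ltW.
apply: le_trans h4; rewrite exprMn; move: h2 h3; lra.
Qed.

(** A failed trial has [y] different from the extrapolated point, so the
    quadratic terms can be compared. *)
Lemma double_step_max s y : trial_fails chi f s y -> fs_L s * 2 <= Lmax.
Proof.
rewrite /trial_fails => fail; have := lt_le_trans fail (f_upper y (fs_xtilde s)).
rewrite ltrD2l; set e := enorm _ ^+ 2 => lt.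
have e0 : 0 < e.
  rewrite lt_def sqr_ge0 andbT; apply/eqP => e0; move: lt.
  by rewrite e0 !mulr0 ltxx.
have /andP[_ chi1] := chi01.
by move: lt; rewrite ltr_pM2r // /Lmax ler_pdivlMr ?subr_gt0 //; lra.
Qed.

Lemma enorm_fs_v s y : 0 < fs_L s ->
  enorm (fs_v f s y) <= (Lf + fs_L s) * enorm (y - fs_xtilde s).
Proof.
move=> L0; apply: (le_trans (enormD _ _)); rewrite mulrDl lerD //.
by rewrite /fs_s enormZ gtr0_norm // enormB.
Qed.

(** A large residual forces [|y - xt|] to be large, while the test bounds it
    by [D / sqrt (chi A L)], and [A L] grows geometrically. *)
Lemma iteration_le s y (J : nat) : cycle_wf s -> fs_L s <= Lmax ->
    trial_point f h s y -> cycle_test chi s y ->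
    eps < enorm (fs_v f s y) -> (1 + q) ^+ J <= fs_nextA s * fs_L s ->
  J.+1%:R <= iteration_max.
Proof.
move=> wf L_le tr test big grow.
set e := enorm (y - fs_xtilde s).
set D := diameter (edom h).
have L0 := wf_L_gt0 wf; have hy := trial_edom L0 tr.
have chi0 : 0 < chi by case/andP: chi01.
have Lmax0 := step_max_gt0.
have D0 : 0 <= D by apply: diameter_ge0 => //; exists y.
have e0 : 0 <= e := enorm_ge0 _.
have ve : enorm (fs_v f s y) <= 2 * Lmax * e.
  apply: (le_trans (enorm_fs_v y L0)); rewrite ler_wpM2r //.
  by have := step_max_ge; have := Lf_gt0; move: L_le; lra.
have yD : enorm (y - fs_x0 s) <= D by apply: enorm_le_diameter => //; exact: wf_x0.
have AL := nextA_ge1 wf.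
have grow0 : 0 < (1 + q) ^+ J.
  by rewrite exprn_gt0 // addr_gt0 // growth_rate_gt0.
have eD : chi * (1 + q) ^+ J * e ^+ 2 <= D ^+ 2.
  apply: (@le_trans _ _ (chi * fs_nextA s * fs_L s * e ^+ 2)).
    by rewrite ler_wpM2r ?sqr_ge0 // -mulrA ler_pM2l.
  apply: (le_trans test).
  by rewrite ler_pXn2r ?nnegrE ?enorm_ge0.
have epos : 0 < e.
  rewrite lt_def e0 andbT; apply/eqP => ez; move: ve.
  by rewrite ez mulr0 leNgt (le_lt_trans eps_ge0 big).
have Dpos : 0 < D.
  rewrite lt_def D0 andbT; apply/eqP => Dz; move: eD.
  by rewrite Dz expr0n /= leNgt mulr_gt0 ?(exprn_gt0 2) // mulr_gt0.
have eps0 := eps_gt0 Dpos.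
have bound : (1 + q) ^+ J <= (2 * Lmax * D) ^+ 2 / (chi * eps ^+ 2).
  rewrite ler_pdivlMr ?mulr_gt0 ?exprn_gt0 //.
  have eps2 : eps ^+ 2 <= (2 * Lmax * e) ^+ 2.
    have le := lt_le_trans big ve.
    by rewrite ler_pXn2r ?nnegrE // ltW // (le_lt_trans eps_ge0).
  have c0 : 0 <= (1 + q) ^+ J * chi by rewrite mulr_ge0 // ltW.
  rewrite mulrA; apply: (le_trans (ler_wpM2l c0 eps2)).
  have -> : (1 + q) ^+ J * chi * (2 * Lmax * e) ^+ 2 =
      (2 * Lmax) ^+ 2 * (chi * (1 + q) ^+ J * e ^+ 2) by ring.
  by rewrite [leRHS]exprMn ler_wpM2l // sqr_ge0.
have ln_bound : ln ((1 + q) ^+ J) <= ln ((2 * Lmax * D) ^+ 2 / (chi * eps ^+ 2)).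
  by rewrite ler_ln ?posrE // (lt_le_trans grow0).
rewrite /iteration_max -natr1 addrC lerD2l ler_pdivlMr ?ln_growth_gt0 //.
rewrite [leLHS]mulr_natl -lnXn ?le_max ?ln_bound //.
by rewrite addr_gt0 ?growth_rate_gt0.
Qed.

(** The bookkeeping of a run with cost [N]: [k] restarts so far, and, in the
    current cycle, [J] completed iterations and [T] doublings of [L]. *)
Definition run_inv s (N : nat) : Prop := exists k J T : nat,
  [/\ cycle_wf s /\ (fs_mu s <= mubar -> estimate s),
      fs_mu s = mu0 / 2 ^+ k /\ ((0 < k)%N -> mubar < 2 * fs_mu s),
      2 ^+ T * M0 <= fs_L s <= Lmax,
      ((0 < J)%N -> (1 + q) ^+ J.-1 <= fs_A s * fs_L s) /\
        J%:R <= iteration_max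
    & N%:R <= k%:R * cycle_cost + 2 * J%:R + T%:R].

Lemma M0_le_step_max : M0 <= Lmax.
Proof.
by apply: (le_trans M0_le); have := step_max_ge; have := Lf_gt0; lra.
Qed.

Lemma cycle_cost_ge0 : 0 <= cycle_cost.
Proof.
rewrite /cycle_cost; have := iteration_max_ge1; have := doubling_max_ge0; lra.
Qed.

Lemma run_inv_start x : edom h x -> run_inv (cycle_start mu0 M0 x) 0.
Proof.
move=> hx; exists 0%N, 0%N, 0%N; split => /=.
- split; last by move=> _; exact: estimate_start.
  by apply: start_wf => //; exact: lt_le_trans mu0_ge.
- by rewrite expr0 divr1.
- by rewrite expr0 mul1r lexx M0_le_step_max.
- by split => //; apply: le_trans iteration_max_ge1.
- by rewrite mul0r mulr0 !addr0.
Qed.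

(** The slack of 2 pays for the accepted trial that ends the run. *)
Lemma run_inv_cost s N : run_inv s N -> N%:R + 2 <= run_cost.
Proof.
move=> [k [J [T [_ [muE mu_lt] /andP[TL LL] [_ Jm] Nle]]]].
have km : k%:R <= restart_max by apply: restart_le; rewrite -muE.
have Tm : T%:R <= doubling_max.
  apply: log2_le_of_pow; rewrite ler_pdivlMr //; exact: le_trans TL LL.
have : k%:R * cycle_cost <= restart_max * cycle_cost.
  by rewrite ler_wpM2r // cycle_cost_ge0.
rewrite /run_cost mulrDl mul1r {4}/cycle_cost; move: Nle; lra.
Qed.

Lemma run_inv_wf s N : run_inv s N -> cycle_wf s.
Proof. by move=> [k [J [T [[]]]]]. Qed.

Lemma run_inv_step s N c s' : run_inv s N ->
  rfista_step chi M0 eps f h s c (inl s') -> run_inv s' (N + c).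
Proof.
move=> inv step; have cost := run_inv_cost inv.
case: inv => k [J [T [[wf est] [muE mu_lt] /andP[TL LL] [grow Jm] Nle]]].
have L0 := wf_L_gt0 wf.
have mu_ge : mubar / 2 <= fs_mu s.
  case: k muE mu_lt {Nle} => [-> _|k _ /(_ isT)]; last lra.
  by rewrite expr0 divr1; have := mu0_ge; have := mubar_gt0; lra.
inversion step; subst.
- exists k, J, T.+1; split => /=.
  + split; first exact: double_wf.
    exact: est.
  + by split.
  + rewrite exprS -mulrA ler_pM2l // TL /=.
    by rewrite mulrC; apply: double_step_max; eassumption.
  + split => // /grow; move/le_trans; apply.
    by rewrite mulrCA ler_peMl ?ler1n // mulr_ge0 ?(wf_A wf) // ltW.
  + by rewrite natrD -[T.+1%:R]natr1; move: Nle; lra.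
- have mu_big : mubar < fs_mu s.
    rewrite ltNge; apply/negP => mu_le.
    have fails : ~ cycle_test chi s y by [].
    by apply: fails; apply: estimate_cycle_test => //; exact: est.
  have : Num.max (fs_L s / 4) M0 <= M <= fs_L s by [].
  rewrite ge_max => /andP[/andP[_ MM] ML].
  exists k.+1, 0%N, 0%N; split => /=.
  + split; last by move=> _; exact: estimate_start.
    by apply: start_wf => //; rewrite divr_gt0 // (wf_mu wf).
  + split; last by move=> _; rewrite mulrC divfK.
    by rewrite muE exprSr invfM mulrA.
  + by rewrite expr0 mul1r MM /= (le_trans ML).
  + by split => //; apply: le_trans iteration_max_ge1.
  + have Tm : T%:R <= doubling_max.
      apply: log2_le_of_pow; rewrite ler_pdivlMr //; exact: le_trans TL LL.
    rewrite natrD -[k.+1%:R]natr1 mulr0 !addr0 mulrDl mul1r {2}/cycle_cost.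
    by move: Nle Jm; lra.
- have grow' : (1 + q) ^+ J <= fs_nextA s * fs_L s.
    case: J grow {Jm Nle} => [_|J /(_ isT) grow].
      by rewrite expr0; exact: nextA_ge1.
    apply: le_trans (nextA_growth wf mu_ge LL).
    by rewrite exprS ler_pM2l // addr_gt0 // growth_rate_gt0.
  exists k, J.+1, T; split => /=.
  + split; first exact: (next_wf wf).
    move=> mu_le u hu.
    have tr : trial_point f h s y by [].
    have acc : ~ trial_fails chi f s y by [].
    have := estimate_next wf tr acc mu_le (est mu_le) hu.
    apply: le_trans; rewrite lerDl mulr_ge0 ?sqr_ge0 // !mulr_ge0 //.
    * by case/andP: chi01 => /ltW.
    * by rewrite addr_ge0 ?(wf_A wf) // ltW //; have [] := fs_aE wf.
    * exact: ltW.
  + by split.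
  + by rewrite TL.
  + split => //; exact: (@iteration_le s y J).
  + by rewrite natrD -[J.+1%:R]natr1; move: Nle; lra.
Qed.

Lemma run_output s N c y v : run_inv s N ->
    rfista_step chi M0 eps f h s c (inr (y, v)) ->
  [/\ (N + c)%:R <= run_cost, edom h y, enorm v <= eps &
      subdiff h y (v - grad f y)].
Proof.
move=> inv step; have cost := run_inv_cost inv.
have L0 := wf_L_gt0 (run_inv_wf inv).
inversion step; subst.
have tr : trial_point f h s y by [].
have hy := trial_edom L0 tr.
split=> //; first by rewrite natrD.
apply/(subdiffP h_proper _ hy) => u hu.
have -> : fs_v f s y - grad f y = fs_s s y - grad f (fs_xtilde s).
  by apply/matrixP => i j; rewrite /fs_v !mxE; ring.
exact: trial_subgradient.
Qed.

End Subproblem.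
(** * The augmented Lagrangian method *)

Section AugmentedLagrangian.
Context {R : realType} {n m : nat} (P : problem R n m).
Local Notation E := 'cV[R]_n.
Local Notation A := (Amap P).
Local Notation b := (bvec P).
Local Notation L := (smooth_lagrangian P).
Implicit Types (x y z u v : E) (p q : 'cV[R]_m).
Hypothesis std : standing_assumptions P.

(** ** The smooth part of the subproblems *)

Definition penalty (c : R) p z : R :=
  dot p (A *m z - b) + c / 2 * enorm (A *m z - b) ^+ 2.

Definition penalty_grad (c : R) p z : E := A^T *m (p + c *: (A *m z - b)).

Lemma smooth_lagrangianE c p z : L c p z = psi_s P z + penalty c p z.
Proof. by rewrite /smooth_lagrangian /penalty addrA. Qed.

Lemma penaltyD c p z v :
  penalty c p (v + z)
    = penalty c p z + dot (penalty_grad c p z) v + c / 2 * enorm (A *m v) ^+ 2.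
Proof.
rewrite /penalty /penalty_grad (dotC _ v) -dot_mulmx mulmxDr -addrA.
set w := A *m v; set g := A *m z - b; clearbody w g.
by rewrite !sqr_enorm !dotE (dotC p w) (dotC g w); field.
Qed.

Lemma psi_s_gradient : has_gradient (psi_s P).
Proof. by apply: differentiable_has_gradient; exact: psi_s_differentiable. Qed.

Lemma is_derive_lagrangian c p x v :
  is_derive x v (L c p) (dot (grad (psi_s P) x + penalty_grad c p x) v).
Proof.
have -> : L c p = psi_s P + penalty c p.
  by apply/funext => z; rewrite smooth_lagrangianE.
rewrite dotDl; apply: is_deriveD; first exact: psi_s_gradient.
apply: (@is_derive_quadratic _ _ _ _ _ _ (c / 2 * enorm (A *m v) ^+ 2)) => t.
rewrite penaltyD dotZr -scalemxAr enormZ exprMn real_normK ?num_real //.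
ring.
Qed.

Lemma grad_lagrangian c p x :
  grad (L c p) x = grad (psi_s P) x + penalty_grad c p x.
Proof. by apply: gradE => v; exact: is_derive_lagrangian. Qed.

Lemma lagrangian_gradient c p : has_gradient (L c p).
Proof. by move=> x v; rewrite grad_lagrangian; exact: is_derive_lagrangian. Qed.

Lemma lagrangian_lower c p u x : 0 <= c -> linearization (L c p) u x <= L c p u.
Proof.
move=> c0; rewrite /linearization grad_lagrangian dotDl !smooth_lagrangianE.
have := convex_grad_lower x u psi_s_gradient (psi_s_convex std).
have := penaltyD c p x (u - x); rewrite subrK => ->.
have : 0 <= c / 2 * enorm (A *m (u - x)) ^+ 2.
  by rewrite mulr_ge0 ?sqr_ge0 // divr_ge0.
rewrite /linearization; lra.
Qed.

Lemma lagrangian_lipschitz (eps : R) p : 0 < eps ->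
  lipschitz_grad (lagrangian_L P eps) (L eps^-1 p).
Proof.
move=> eps0 x y; rewrite !grad_lagrangian opprD addrACA.
apply: (le_trans (enormD _ _)); rewrite /lagrangian_L mulrDl.
apply: lerD; first exact: psi_s_lipschitz.
have -> : penalty_grad eps^-1 p x - penalty_grad eps^-1 p y
    = eps^-1 *: (A^T *m (A *m (x - y))).
  rewrite /penalty_grad -mulmxBr scalemxAr; congr (_ *m _).
  rewrite opprD addrACA subrr add0r -scalerBr mulmxBr; congr (_ *: _).
  by rewrite opprB addrA subrK.
rewrite enormZ gtr0_norm ?invr_gt0 // mulrAC [leRHS]mulrC.
rewrite ler_pM2l ?invr_gt0 //; apply: (le_trans (enorm_trmulmx _ _)).
by rewrite expr2 -mulrA ler_wpM2l ?opnorm_ge0 // enorm_mulmx.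
Qed.

Local Notation hr := (fun z => fine (psi_n P z)).

Lemma psi_fin z : edom (psi_n P) z -> psi P z = (psi_s P z + hr z)%:E.
Proof.
by move=> hz; rewrite /psi (edom_fineE (psi_n_proper std) hz) EFinD.
Qed.

(** The linear and quadratic terms in [A z - b] are convex, so the subproblems
    inherit the modulus of [psi]. *)
Lemma lagrangian_midpoint (mu c : R) p x y : 0 <= c ->
    strongly_convex mu (psi P) -> edom (psi_n P) x -> edom (psi_n P) y ->
  L c p (2^-1 *: x + (1 - 2^-1) *: y) + hr (2^-1 *: x + (1 - 2^-1) *: y)
    <= (L c p x + hr x) / 2 + (L c p y + hr y) / 2
       - mu / 8 * enorm (x - y) ^+ 2.
Proof.
move=> c0 sc hx hy.
have half01 : 0 < (2^-1 : R) < 1 by lra.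
have [hm _] := econvex_fine (psi_n_proper std) (psi_n_convex std) hx hy half01.
have := sc x y _ half01; rewrite !psi_fin // -!EFinB -!EFinM -EFinD lee_fin.
rewrite !smooth_lagrangianE.
set mid := 2^-1 *: x + (1 - 2^-1) *: y.
have midE1 : mid = (2^-1 *: (y - x)) + x.
  by apply/matrixP => i j; rewrite /mid !mxE; field.
have yE : y = (y - x) + x by rewrite subrK.
have pen : penalty c p mid <= penalty c p x / 2 + penalty c p y / 2.
  have := penaltyD c p x (y - x); rewrite -yE => ->.
  rewrite midE1 penaltyD dotZr -scalemxAr enormZ exprMn gtr0_norm ?invr_gt0 //.
  have : 0 <= c / 2 * enorm (A *m (y - x)) ^+ 2.
    by rewrite mulr_ge0 ?sqr_ge0 // divr_ge0.
  lra.
have norms : enorm mid ^+ 2 = enorm x ^+ 2 / 2 + enorm y ^+ 2 / 2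
    - enorm (x - y) ^+ 2 / 4.
  by rewrite /mid !sqr_enorm !dotE (dotC y x); field.
rewrite norms; move: pen; lra.
Qed.

(** ** Progress in the dual *)

Lemma dual_le p z : edom (psi_n P) z ->
  (dual P p <= (psi_s P z + hr z + dot p (A *m z - b))%:E)%E.
Proof.
by move=> hz; apply: ereal_inf_lbound; exists z; rewrite // psi_fin // -EFinD.
Qed.

(** The point [z] minimizes the Lagrangian at [p] up to the linear term
    [<r, u - z>]. *)
Lemma dual_ge p z r (d : R) : edom (psi_n P) z -> kkt_residual P z p r ->
    (forall u, edom (psi_n P) u -> - d <= dot r (u - z)) ->
  ((psi_s P z + hr z + dot p (A *m z - b) - d)%:E <= dual P p)%E.
Proof.
move=> hz /(subdiffP (psi_n_proper std) _ hz) kkt rd.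
apply: le_ereal_inf_tmp => _ [u _ <-].
have [hu|hu] := pselect (edom (psi_n P) u); last first.
  by rewrite /psi (nedomE hu) addey // addye // leey.
rewrite psi_fin // -EFinD lee_fin.
have := convex_grad_lower z u psi_s_gradient (psi_s_convex std).
have := kkt u hu; have := rd u hu; rewrite /linearization.
rewrite !dotDl !dotNl -[dot (A^T *m p) _]dotC -dot_mulmx.
have -> : A *m (u - z) = (A *m u - b) - (A *m z - b).
  by rewrite mulmxBr opprB addrA subrK.
rewrite [dot (_ - _) p]dotC.
set gu := A *m u - b; set gz := A *m z - b; clearbody gu gz.
rewrite (dotDr gu) (dotNr gz); lra.
Qed.

(** The multiplier update is an inexact proximal point step on the dual
    function: the constraint residual is a [d]-supergradient at the new
    multiplier. *)
Lemma multiplier_contraction (eps d : R) p ps z r : 0 < eps ->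
    edom (psi_n P) z -> dual_solutions P ps ->
    kkt_residual P z (next_multiplier P eps p z) r ->
    (forall u, edom (psi_n P) u -> - d <= dot r (u - z)) ->
  enorm (next_multiplier P eps p z - ps) ^+ 2
    + eps^-1 ^+ 2 * enorm (A *m z - b) ^+ 2
  <= enorm (p - ps) ^+ 2 + 2 * eps^-1 * d.
Proof.
move=> eps0 hz sol kkt rd.
have := le_trans (le_trans (dual_ge hz kkt rd) (sol _)) (dual_le ps hz).
rewrite lee_fin /next_multiplier.
set g := A *m z - b; clearbody g; set c := eps^-1 => le.
have c0 : 0 <= c by rewrite invr_ge0 ltW.
have : 0 <= c * (dot ps g - dot (p + c *: g) g + d).
  by rewrite mulr_ge0 //; move: le; lra.
rewrite !sqr_enorm !dotE (dotC g p) (dotC g ps) (dotC ps p); lra.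
Qed.

Lemma dom_diam_ge0 : 0 <= dom_diam P.
Proof.
apply: diameter_ge0; first exact: psi_n_dom_compact.
exact: (proj2 (psi_n_proper std)).
Qed.

Lemma subproblem_tol_ge0 (eps rho : R) : 0 < eps -> 0 < rho ->
  0 <= subproblem_tol P eps rho.
Proof.
move=> eps0 rho0; rewrite le_min (ltW rho0) andbT divr_ge0 ?(ltW eps0) //.
by rewrite mulr_ge0 // dom_diam_ge0.
Qed.

Lemma subproblem_tol_gt0 (eps rho : R) : 0 < eps -> 0 < rho ->
  0 < dom_diam P -> 0 < subproblem_tol P eps rho.
Proof.
by move=> eps0 rho0 D0; rewrite lt_min rho0 andbT divr_gt0 // mulr_gt0.
Qed.

(** The tolerance is at most [eps / (4 D)] if [D > 0], and it is 0 if
    [D = 0]. *)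
Lemma tolerance_slack (eps rho : R) z u r : 0 < eps -> 0 < rho ->
    edom (psi_n P) z -> edom (psi_n P) u ->
    enorm r <= subproblem_tol P eps rho ->
  - (eps / 4) <= dot r (u - z).
Proof.
move=> eps0 rho0 hz hu rle; rewrite lerNl -dotNl.
apply: (le_trans (dot_le_enorm _ _)); rewrite enormN.
have uz : enorm (u - z) <= dom_diam P.
  by apply: enorm_le_diameter => //; exact: psi_n_dom_compact.
apply: (le_trans (ler_pM (enorm_ge0 _) (enorm_ge0 _) rle uz)).
have [->|D0] := eqVneq (dom_diam P) 0; first by rewrite mulr0 divr_ge0 // ltW.
have Dpos : 0 < dom_diam P by rewrite lt_def D0 dom_diam_ge0.
apply: (@le_trans _ _ (eps / (4 * dom_diam P) * dom_diam P)).
  by rewrite ler_wpM2r ?dom_diam_ge0 // ge_min lexx.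
by rewrite invfM mulrA divfK.
Qed.

Lemma kkt_of_subproblem (eps : R) p z v :
  subdiff (psi_n P) z (v - grad (L eps^-1 p) z) ->
  kkt_residual P z (next_multiplier P eps p z) v.
Proof. by rewrite /kkt_residual grad_lagrangian opprD addrA. Qed.

Lemma dual_dist2_ge p (t : R) : 0 <= t -> dual_solutions P !=set0 ->
  (forall ps, dual_solutions P ps -> t <= enorm (p - ps) ^+ 2) ->
  t <= dual_dist2 P p.
Proof.
move=> t0 [ps0 sol0] le.
have : Num.sqrt t <= Defs.dist p (dual_solutions P).
  apply: lb_le_inf; first by exists (enorm (p - ps0)), ps0.
  move=> _ [ps sol <-]; rewrite -(ger0_norm (enorm_ge0 _)) -sqrtr_sqr.
  by rewrite ler_sqrt ?sqr_ge0 // le.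
rewrite /dual_dist2 => h; rewrite -(sqr_sqrtr t0) ler_pXn2r ?nnegrE ?sqrtr_ge0 //.
by apply: le_trans h; exact: sqrtr_ge0.
Qed.

End AugmentedLagrangian.
(** ** Counting outer iterations *)

Section OuterLoop.
Context {R : realType} {n m : nat} (P : problem R n m).
Context (chi mubar mu0 M0 eps rho : R) (z0 : 'cV[R]_n) (p0 : 'cV[R]_m).
Hypothesis chi01 : 0 < chi < 1.
Hypothesis setting : oial_setting P mubar mu0 M0 z0.
Hypothesis eps_gt0 : 0 < eps.
Hypothesis rho_gt0 : 0 < rho.
Local Notation A := (Amap P).
Local Notation b := (bvec P).
Local Notation h := (psi_n P).
Local Notation Lf := (lagrangian_L P eps).
Local Notation tol := (subproblem_tol P eps rho).
Local Notation L p := (smooth_lagrangian P eps^-1 p).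

Let std : standing_assumptions P := setting_standing setting.
Let h_proper := psi_n_proper std.

Lemma initial_estimate_bounds : 0 < M0 /\ M0 <= 2 * Lbar P.
Proof.
case: (setting_M0 setting) => [[w0 [_ wz gwz ->]]|[_ M0_pos M0L]]; last by [].
have d0 : 0 < enorm (z0 - w0) by rewrite enorm_gt0 subr_eq0 eq_sym.
have g0 : 0 < enorm (grad (psi_s P) z0 - grad (psi_s P) w0).
  by rewrite enorm_gt0 subr_eq0 eq_sym.
have d4 : 0 < 4 * enorm (z0 - w0) by rewrite mulr_gt0.
split; first by rewrite divr_gt0.
rewrite ler_pdivrMr // (le_trans (psi_s_lipschitz std _ _)) //.
have := lt_le_trans g0 (psi_s_lipschitz std z0 w0).
lra.
Qed.

Lemma Lbar_le_lagrangian_L : Lbar P <= Lf.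
Proof. by rewrite lerDl divr_ge0 ?sqr_ge0 // ltW. Qed.

Lemma lagrangian_L_gt0 : 0 < Lf.
Proof.
apply: lt_le_trans Lbar_le_lagrangian_L.
by have [M0_pos M0L] := initial_estimate_bounds; lra.
Qed.

Lemma initial_estimate_le : M0 <= 2 * Lf.
Proof.
have [_ M0L] := initial_estimate_bounds.
by have := Lbar_le_lagrangian_L; lra.
Qed.

Let M0_gt0 : 0 < M0 := proj1 initial_estimate_bounds.
Let c_ge0 : 0 <= eps^-1. Proof. by rewrite invr_ge0 ltW. Qed.
Let tol_ge0 := subproblem_tol_ge0 std eps_gt0 rho_gt0.

Local Notation run p := (run_inv chi M0 tol mubar Lf (L p) h mu0).
Local Notation cost := (run_cost chi M0 tol mubar Lf h mu0).

Lemma oial_run_start p z : edom h z -> run p (cycle_start mu0 M0 z) 0.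
Proof.
move=> hz; apply: run_inv_start => //.
- exact: setting_mubar setting.
- exact: lagrangian_L_gt0.
- exact: initial_estimate_le.
- exact: setting_mu0 setting.
Qed.

Lemma oial_run_step p s N c s' : run p s N ->
  rfista_step chi M0 tol (L p) h s c (inl s') -> run p s' (N + c).
Proof.
apply: run_inv_step => //.
- by move=> u x; exact: lagrangian_lower.
- move=> y x; apply: lipschitz_grad_upper.
  + exact: lagrangian_gradient.
  + exact: ltW lagrangian_L_gt0.
  + exact: lagrangian_lipschitz.
- exact: lagrangian_lipschitz.
- exact: psi_n_convex.
- exact: psi_n_dom_compact.
- exact: setting_mubar setting.
- by move=> x y; apply: lagrangian_midpoint => //; exact: setting_strong setting.
- exact: lagrangian_L_gt0.
- exact: initial_estimate_le.
- exact: subproblem_tol_gt0.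
- exact: setting_mu0 setting.
Qed.

Lemma oial_run_output p s N c z r : run p s N ->
    rfista_step chi M0 tol (L p) h s c (inr (z, r)) ->
  [/\ (N + c)%:R <= cost, edom h z, enorm r <= tol &
      kkt_residual P z (next_multiplier P eps p z) r].
Proof.
move=> inv step.
have [hN hz hr sub] := run_output chi01 h_proper (psi_n_convex std)
  (setting_mubar setting) M0_gt0 lagrangian_L_gt0 initial_estimate_le inv step.
by split => //; exact: kkt_of_subproblem.
Qed.

(** An outer iteration that does not stop has [|A z - b| / eps > 1],
    while the tolerance on the subproblem spoils the contraction by 1/2 only. *)
Lemma multiplier_decrease p ps z r : edom h z -> enorm r <= tol ->
    kkt_residual P z (next_multiplier P eps p z) r ->
    eps < enorm (A *m z - b) -> dual_solutions P ps ->
  enorm (next_multiplier P eps p z - ps) ^+ 2 + 2^-1 <= enorm (p - ps) ^+ 2.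
Proof.
move=> hz hr kkt big sol.
have slack u : edom h u -> - (eps / 4) <= dot r (u - z).
  by move=> hu; exact: tolerance_slack hr.
have := multiplier_contraction std eps_gt0 hz sol kkt slack.
have -> : 2 * eps^-1 * (eps / 4) = 2^-1 by field; rewrite gt_eqF.
have : 1 <= eps^-1 ^+ 2 * enorm (A *m z - b) ^+ 2.
  rewrite -exprMn -[leLHS](expr1n _ 2) ler_pXn2r ?nnegrE ?mulr_ge0 ?enorm_ge0 //.
  by rewrite mulrC ler_pdivlMr // mul1r ltW.
lra.
Qed.

(** What [K] outer iterations from [p0] to [p] guarantee. *)
Definition decrease_count (K : nat) p : Prop :=
  forall ps, dual_solutions P ps ->
    enorm (p - ps) ^+ 2 + K%:R / 2 <= enorm (p0 - ps) ^+ 2.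

(** [N1] is the cost of the completed outer iterations and [N2] that of the
    current one. *)
Definition oial_inv (N : nat) (st : oial_state) : Prop :=
  match st with
  | OialRun p s => exists N1 N2 K,
      [/\ N = (N1 + N2)%N, N1%:R <= K%:R * cost, decrease_count K p &
          run p s N2]
  | OialDone z p r => approximate_solution P eps rho z p r /\
      exists K q, decrease_count K q /\ N%:R <= (K%:R + 1) * cost
  end.

Lemma oial_inv_exec N st :
  oial_exec P chi mu0 M0 eps rho z0 p0 N st -> oial_inv N st.
Proof.
elim=> {N st} [|N st k st' _ inv step].
  exists 0%N, 0%N, 0%N; split => //; first by rewrite mul0r.
    by move=> ps _; rewrite mul0r addr0.
  exact/oial_run_start/(setting_z0 setting).
case: step inv => {st k st'}.
- move=> p s k s' step [N1 [N2 [K [-> N1le dec inv]]]].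
  exists N1, (N2 + k)%N, K; split => //; first by rewrite addnA.
  exact: oial_run_step step.
- move=> p s k z r step big [N1 [N2 [K [-> N1le dec inv]]]].
  have [Nle hz hr kkt] := oial_run_output inv step.
  exists (N1 + N2 + k)%N, 0%N, K.+1; split.
  + by rewrite addn0.
  + by rewrite -addnA natrD -natr1 mulrDl mul1r lerD.
  + move=> ps sol; have := multiplier_decrease hz hr kkt big sol.
    by have := dec ps sol; rewrite -[K.+1%:R]natr1; lra.
  + exact: oial_run_start.
- move=> p s k z r step small [N1 [N2 [K [-> N1le dec inv]]]].
  have [Nle hz hr kkt] := oial_run_output inv step; split.
    split => //; apply: (le_trans hr); by rewrite ge_min lexx orbT.
  exists K, p; split => //.
  by rewrite -addnA natrD mulrDl mul1r lerD.
Qed.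

Lemma oial_run_cost p s N : run p s N -> N%:R + 2 <= cost.
Proof.
apply: run_inv_cost => //; first exact: setting_mubar setting.
  exact: lagrangian_L_gt0.
exact: initial_estimate_le.
Qed.

Lemma cost_ge0 : 0 <= cost.
Proof.
have := oial_run_cost (oial_run_start p0 (setting_z0 setting)).
by apply: le_trans; rewrite add0r.
Qed.

Lemma decrease_count_le K p : decrease_count K p ->
  K%:R <= 2 * dual_dist2 P p0.
Proof.
move=> dec; have [_ [ps [_ _ sol]]] := setting_optimal setting.
suff : K%:R / 2 <= dual_dist2 P p0 by lra.
apply: dual_dist2_ge; first by rewrite divr_ge0.
  by exists ps.
by move=> q /dec; have := sqr_ge0 (enorm (p - q)); lra.
Qed.

Lemma oial_solves_run_cost :
  oial_solves_within P chi mu0 M0 eps rho z0 p0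
    ((2 * dual_dist2 P p0 + 1) * cost).
Proof.
move=> N st /oial_inv_exec; case: st => [p s|z p r] /=.
  move=> [N1 [N2 [K [-> N1le dec inv]]]].
  have N2le : N2%:R <= cost by apply: le_trans (oial_run_cost inv); rewrite lerDl.
  split.
    rewrite natrD mulrDl mul1r lerD // (le_trans N1le) // ler_wpM2r ?cost_ge0 //.
    exact: decrease_count_le dec.
  have [k [[s'|[z r]] step]] := rfista_progress chi tol (L p) h_proper
    (psi_n_closed std) (psi_n_dom_compact std) M0_gt0 (run_inv_wf inv).
    by exists k, (OialRun p s'); exact: OialInner.
  have [stop|next] := leP (enorm (A *m z - b)) eps.
    by exists k, (OialDone z (next_multiplier P eps p z) r); exact: OialStop step _.
  by exists k, (oial_start mu0 M0 (next_multiplier P eps p z) z); exact: OialNext step _.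
move=> [app [K [q [dec Nle]]]]; split => //; apply: (le_trans Nle).
by rewrite ler_wpM2r ?cost_ge0 // lerD2r (decrease_count_le dec).
Qed.

End OuterLoop.
(** * The cost of one subproblem in closed form *)

Section RunCost.
Context {R : realType} (chi : R).
Hypothesis chi01 : 0 < chi < 1.

Let chi0 : 0 < chi. Proof. by case/andP: chi01. Qed.
Let chi1 : 0 < 1 - chi. Proof. by rewrite subr_gt0; case/andP: chi01. Qed.
Let chi1_le1 : 1 - chi <= 1. Proof. by have := chi0; lra. Qed.

(** [rate_const * sqrt (Lf / mubar)] is the inverse of [growth_rate]; the
    other two are the parts of the logarithms that depend on [chi]. *)
Definition rate_const : R := Num.sqrt (32 / (1 - chi)).
Definition log_const : R := ln ((16 / (1 - chi)) ^+ 2 / chi).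
Definition doubling_const : R := log2 (8 / (1 - chi)).
Definition cost_const : R :=
  2 * (2 * (1 + (log_const + 2) * (1 + rate_const)) + doubling_const + 2).

Lemma log_const_ge0 : 0 <= log_const.
Proof.
apply: ln_ge0; rewrite ler_pdivlMr // mul1r.
have le1 : 1 <= 16 / (1 - chi).
  by rewrite ler_pdivlMr // mul1r (le_trans chi1_le1) ?ler1n.
by apply: le_trans (exprn_ege1 2 le1); have := chi1; lra.
Qed.

Lemma doubling_const_ge0 : 0 <= doubling_const.
Proof.
by apply: (@log2_le_of_pow _ 0); rewrite expr0 ler_pdivlMr // mul1r (le_trans chi1_le1) ?ler1n.
Qed.

Lemma cost_const_gt0 : 0 < cost_const.
Proof.
have := doubling_const_ge0.
have : 0 <= (log_const + 2) * (1 + rate_const).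
  by rewrite mulr_ge0 ?addr_ge0 ?log_const_ge0 ?sqrtr_ge0.
by rewrite /cost_const; lra.
Qed.

Lemma lnpp_ge1 (t : R) : 1 <= lnpp t.
Proof. by rewrite le_max lexx orbT. Qed.

(** This is [ln (1 + x) <= x] at [x = - q / (1 + q)]. *)
Lemma ln_lower (q : R) : 0 < q -> q / (1 + q) <= ln (1 + q).
Proof.
move=> q0; have q1 : 0 < 1 + q by lra.
have := @le_ln1Dx R (- (q / (1 + q))).
have -> : 1 + - (q / (1 + q)) = (1 + q)^-1 by field; rewrite gt_eqF.
rewrite lnV ?posrE // lerN2; apply.
by rewrite ltrN2 ltr_pdivrMr //; lra.
Qed.

Section Costs.
Context {n : nat} (M0 tol mubar Lf mu0 : R) (h : 'cV[R]_n -> \bar R).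
Hypothesis mubar_gt0 : 0 < mubar.
Hypothesis M0_gt0 : 0 < M0.
Hypothesis Lf_gt0 : 0 < Lf.
Hypothesis tol_ge0 : 0 <= tol.
Hypothesis D_ge0 : 0 <= diameter (edom h).

Local Notation kappa := (Num.max (Lf / mubar) 1).
Local Notation D := (diameter (edom h)).
Local Notation q := (growth_rate chi mubar Lf).

Let sqrt_kappa_ge1 : 1 <= Num.sqrt kappa.
Proof. by rewrite -[leLHS]sqrtr1 ler_wsqrtr // le_max lexx orbT. Qed.

(** By [ln_lower], [1 / ln (1 + q) <= 1 + 1 / q]. *)
Lemma inv_ln_growth_le : (ln (1 + q))^-1 <= (1 + rate_const) * Num.sqrt kappa.
Proof.
have q0 : 0 < q by exact: growth_rate_gt0.
apply: (@le_trans _ _ (1 + q^-1)).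
  have -> : 1 + q^-1 = (q / (1 + q))^-1.
    by field; rewrite !gt_eqF //=; lra.
  rewrite lef_pV2 ?posrE ?ln_growth_gt0 ?ln_lower // divr_gt0 //; lra.
rewrite mulrDl mul1r lerD // /rate_const -sqrtrM ?divr_ge0 ?(ltW chi1) //.
rewrite /growth_rate -sqrtrV; last first.
  by rewrite ltW // divr_gt0 // mulr_gt0 // step_max_gt0.
apply: ler_wsqrtr; rewrite /step_max.
have -> : (mubar / (4 * (8 * Lf / (1 - chi))))^-1 = 32 / (1 - chi) * (Lf / mubar).
  by field; rewrite !gt_eqF.
by rewrite ler_wpM2l ?divr_ge0 ?(ltW chi1) // le_max lexx.
Qed.

Lemma ln_ratio_le :
  Num.max (ln ((2 * step_max chi Lf * D) ^+ 2 / (chi * tol ^+ 2))) 0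
    <= (log_const + 2) * lnpp (D * Lf / tol).
Proof.
set Y := lnpp _; have Y1 : 1 <= Y := lnpp_ge1 _.
have G0 := log_const_ge0.
have rhs0 : 0 <= (log_const + 2) * Y by rewrite mulr_ge0 ?addr_ge0 // (le_trans ler01).
rewrite ge_max rhs0 andbT.
have -> : (2 * step_max chi Lf * D) ^+ 2 / (chi * tol ^+ 2) =
    (16 / (1 - chi)) ^+ 2 / chi * (D * Lf / tol) ^+ 2.
  by rewrite /step_max invfM -exprVn; ring.
set t := D * Lf / tol.
have t_ge0 : 0 <= t by rewrite divr_ge0 // mulr_ge0 // ltW.
have [t0|t0] := eqVneq t 0; first by rewrite t0 expr0n mulr0 ln0.
have tpos : 0 < t by rewrite lt_def t0.
have t2 : 0 < t ^+ 2 by rewrite exprn_gt0.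
have c0 : 0 < (16 / (1 - chi)) ^+ 2 / chi by rewrite divr_gt0 // exprn_gt0 // divr_gt0.
rewrite lnM ?posrE // -/log_const.
rewrite lnXn // mulr2n mulrDl lerD //; first by rewrite ler_peMr.
have : ln t <= Y by rewrite le_max lexx.
lra.
Qed.

Lemma iteration_max_le :
  iteration_max chi tol mubar Lf h <=
  (1 + (log_const + 2) * (1 + rate_const))
    * (Num.sqrt kappa * lnpp (D * Lf / tol)).
Proof.
set Y := lnpp _; have Y1 : 1 <= Y := lnpp_ge1 _.
have W1 : 1 <= Num.sqrt kappa * Y by rewrite mulr_ege1.
rewrite mulrDl mul1r lerD //.
have -> : (log_const + 2) * (1 + rate_const) * (Num.sqrt kappa * Y) =
  ((log_const + 2) * Y) * ((1 + rate_const) * Num.sqrt kappa) by ring.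
apply: ler_pM; last exact: inv_ln_growth_le.
- by rewrite le_max lexx orbT.
- by rewrite invr_ge0 ltW // ln_growth_gt0.
- exact: ln_ratio_le.
Qed.

Lemma doubling_max_le : doubling_max chi M0 Lf <= doubling_const + log2p (Lf / M0).
Proof.
have -> : doubling_max chi M0 Lf = doubling_const + log2 (Lf / M0).
  rewrite /doubling_max /doubling_const /log2 -mulrDl -lnM ?posrE ?divr_gt0 //.
  by congr (ln _ / _); rewrite /step_max; field; rewrite !gt_eqF.
by rewrite lerD2l le_max lexx.
Qed.

Lemma run_cost_le : run_cost chi M0 tol mubar Lf h mu0 <=
  cost_const * ((Num.ceil (log2pp (mu0 / mubar)))%:~R *
    (Num.sqrt kappa * lnpp (D * Lf / tol) + log2p (Lf / M0))).
Proof.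
set c : R := _%:~R; have c1 : 1 <= c by exact: restart_max_ge1.
have := iteration_max_le; have := doubling_max_le; have := cost_const_gt0.
rewrite /run_cost /cycle_cost -/c /cost_const.
set J0 := 1 + _; set W := Num.sqrt kappa * _; set l := log2p _.
have W1 : 1 <= W by rewrite mulr_ege1 // lnpp_ge1.
have l0 : 0 <= l by rewrite le_max lexx orbT.
have J01 : 1 <= J0.
  rewrite lerDl mulr_ge0 ?addr_ge0 ?log_const_ge0 ?sqrtr_ge0 //.
have T0 := doubling_const_ge0.
move=> C0 Tle Jle.
have h1 : 2 * iteration_max chi tol mubar Lf h + doubling_max chi M0 Lf + 2 <=
    (2 * J0 + doubling_const + 2) * (W + l).
  have : doubling_const <= doubling_const * W by rewrite ler_peMr.
  have : 0 <= (2 * J0 + doubling_const + 1) * l.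
    by rewrite mulr_ge0 // !addr_ge0 // mulr_ge0 // (le_trans ler01).
  by move: Tle Jle; lra.
have c2 : c + 1 <= 2 * c by lra.
have c0 : 0 <= c + 1 by lra.
have b0 : 0 <= (2 * J0 + doubling_const + 2) * (W + l).
  by rewrite mulr_ge0 //; lra.
apply: (le_trans (ler_wpM2l c0 h1)).
apply: (le_trans (ler_wpM2r b0 c2)).
by rewrite le_eqVlt; apply/orP; left; apply/eqP; ring.
Qed.

End Costs.
End RunCost.
(** * Complexity bounds *)

Lemma oial_solves_within_mono (R : realType) (n m : nat) (P : problem R n m)
    (chi mu0 M0 eps rho B B' : R) z0 p0 : B <= B' ->
  oial_solves_within P chi mu0 M0 eps rho z0 p0 B ->
  oial_solves_within P chi mu0 M0 eps rho z0 p0 B'.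
Proof. by move=> BB' H N st /H[NB ?]; split => //; exact: le_trans BB'. Qed.

Lemma log2p_ge0 (R : realType) (t : R) : 0 <= log2p t.
Proof. by rewrite le_max lexx orbT. Qed.

Lemma oial_solves_within_explicit (R : realType) (chi : R) (n m : nat)
    (P : problem R n m) (mubar mu0 M0 : R) z0 p0 (eps rho : R) :
    0 < chi < 1 -> oial_setting P mubar mu0 M0 z0 -> 0 < eps -> 0 < rho ->
  oial_solves_within P chi mu0 M0 eps rho z0 p0
    ((2 * dual_dist2 P p0 + 1) * (cost_const chi *
      ((Num.ceil (log2pp (mu0 / mubar)))%:~R *
       (Num.sqrt (Num.max (lagrangian_L P eps / mubar) 1) *
          lnpp (dom_diam P * lagrangian_L P eps / subproblem_tol P eps rho)
        + log2p (lagrangian_L P eps / M0))))).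
Proof.
move=> chi01 setting eps0 rho0.
have std := setting_standing setting.
have run := @oial_solves_run_cost _ _ _ P _ _ _ _ _ _ _ p0 chi01 setting eps0 rho0.
apply: (oial_solves_within_mono _ run).
have Pi0 : 0 <= dual_dist2 P p0 by exact: sqr_ge0.
rewrite ler_wpM2l //; first lra.
apply: run_cost_le => //.
- exact: setting_mubar setting.
- by have [] := initial_estimate_bounds setting.
- exact: lagrangian_L_gt0 setting eps0.
- exact: subproblem_tol_ge0.
- exact: dom_diam_ge0.
Qed.

(** ** Small tolerances *)

Section SmallTolerance.
Context {R : realType} {n m : nat} (P : problem R n m).
Context (mubar mu0 M0 : R) (z0 : 'cV[R]_n).
Hypothesis setting : oial_setting P mubar mu0 M0 z0.

Let mubar0 : 0 < mubar := setting_mubar setting.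
Let M0_pos : 0 < M0 := proj1 (initial_estimate_bounds setting).
Local Notation D := (dom_diam P).

(** The Lipschitz constant of the subproblems for [eps = 1]; dividing it by
    [eps] bounds the one for smaller [eps]. *)
Definition unit_lipschitz : R := Lbar P + opnorm (Amap P) ^+ 2.
Local Notation B := unit_lipschitz.

Let Lbar0 : 0 < Lbar P.
Proof. by have [? ?] := initial_estimate_bounds setting; lra. Qed.

Lemma unit_lipschitz_gt0 : 0 < B.
Proof. by rewrite ltr_wpDr ?sqr_ge0. Qed.

Definition small_const : R :=
  Num.sqrt (Num.max (B / mubar) 1) *
    (`|ln (D * B / Num.min (4 * D)^-1 1)| + 2) + (`|log2 (B / M0)| + (ln 2)^-1).

Lemma small_const_gt0 : 0 < small_const.
Proof.
apply: ltr_pwDl; last by rewrite addr_ge0 // invr_ge0 ltW // ln2_gt0.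
by rewrite mulr_gt0 ?sqrtr_gt0 ?lt_max ?ltr01 ?orbT // ltr_wpDl.
Qed.

Context (eps : R).
Hypothesis eps0 : 0 < eps.
(* so that [ln eps^-1 >= 1] absorbs additive constants *)
Hypothesis eps_small : eps < expR (- 1).
Local Notation L := (lagrangian_L P eps).

Lemma ln_inv_ge1 : 1 <= ln eps^-1.
Proof.
rewrite lnV ?posrE // lerNr ltW // -(expRK (-1)) ltr_ln ?posrE ?expR_gt0 //.
Qed.

Let eps1 : eps <= 1.
Proof. by apply: (le_trans (ltW eps_small)); rewrite expR_le1 lerN10. Qed.

Let einv1 : 1 <= eps^-1. Proof. by rewrite -[leLHS]invr1 lef_pV2 ?posrE. Qed.

Lemma lagrangian_L_le : L <= B * eps^-1.
Proof.
by rewrite /lagrangian_L mulrDl lerD // ler_peMr // ltW.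
Qed.

Let L0 : 0 < L. Proof. exact: lagrangian_L_gt0 setting eps0. Qed.

Lemma sqrt_condition_le :
  Num.sqrt (Num.max (L / mubar) 1)
    <= Num.sqrt (Num.max (B / mubar) 1) * (Num.sqrt eps)^-1.
Proof.
rewrite -sqrtrV ?(ltW eps0) // -sqrtrM ?le_max ?ler01 ?orbT //.
apply: ler_wsqrtr; rewrite ge_max; apply/andP; split.
  apply: (@le_trans _ _ (B / mubar * eps^-1)).
    by rewrite mulrAC ler_pM2r ?invr_gt0 // lagrangian_L_le.
  by rewrite ler_pM2r ?invr_gt0 // le_max lexx.
by rewrite mulr_ege1 // le_max lexx orbT.
Qed.

Lemma lnpp_ratio_le :
  lnpp (D * L / subproblem_tol P eps eps)
    <= (`|ln (D * B / Num.min (4 * D)^-1 1)| + 2) * ln eps^-1.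
Proof.
have l1 := ln_inv_ge1; set l := ln eps^-1 in l1 *.
set t := Num.min _ _; have std := setting_standing setting.
have tolE : subproblem_tol P eps eps = eps * t.
  by rewrite /subproblem_tol /t -[X in Num.min _ X]mulr1 minr_pMr ?ltW.
have rhs1 : 1 <= (`|ln (D * B / t)| + 2) * l.
  by rewrite mulr_ege1 // (@le_trans _ _ 2) ?ler1n // lerDr.
rewrite ge_max rhs1 andbT tolE.
have [D0|D0] := eqVneq D 0.
  have -> : D * L / (eps * t) = 0 by rewrite D0 !mul0r.
  by rewrite ln0 // (le_trans ler01).
have Dpos : 0 < D by rewrite lt_def D0 dom_diam_ge0.
have t0 : 0 < t by rewrite lt_min ltr01 andbT invr_gt0 mulr_gt0.
have BD0 : 0 < D * B / t by rewrite divr_gt0 // mulr_gt0 // unit_lipschitz_gt0.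
have e2 : 0 < eps^-1 ^+ 2 by rewrite exprn_gt0 // invr_gt0.
apply: (@le_trans _ _ (ln (D * B / t * eps^-1 ^+ 2))).
  have lhs0 : 0 < D * L / (eps * t) by rewrite divr_gt0 // mulr_gt0.
  have rhs0 : 0 < D * B / t * eps^-1 ^+ 2 by rewrite mulr_gt0.
  rewrite ler_ln ?posrE //.
  have -> : D * B / t * eps^-1 ^+ 2 = D * (B * eps^-1) / (eps * t).
    by rewrite invfM; ring.
  rewrite ler_pM2r ?invr_gt0 ?mulr_gt0 // ler_pM2l //.
  exact: lagrangian_L_le.
rewrite lnM ?posrE // lnXn ?invr_gt0 // -/l mulr2n.
have : ln (D * B / t) <= `|ln (D * B / t)| * l.
  by apply: (le_trans (ler_norm _)); rewrite ler_peMr.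
lra.
Qed.

Lemma log2p_ratio_le :
  log2p (L / M0) <= (`|log2 (B / M0)| + (ln 2)^-1) * ln eps^-1.
Proof.
have l1 := ln_inv_ge1; set l := ln eps^-1 in l1 *.
have i0 : 0 < (ln 2 : R)^-1 by rewrite invr_gt0 ln2_gt0.
have rhs0 : 0 <= (`|log2 (B / M0)| + (ln 2)^-1) * l.
  by rewrite mulr_ge0 ?(le_trans ler01 l1) // addr_ge0 // ltW.
rewrite ge_max rhs0 andbT.
have BM0 : 0 < B / M0 by rewrite divr_gt0 // unit_lipschitz_gt0.
apply: (@le_trans _ _ (log2 (B / M0 * eps^-1))).
  have lhs0 : 0 < L / M0 by rewrite divr_gt0.
  rewrite /log2 ler_pM2r // ler_ln ?posrE //; last by rewrite mulr_gt0 ?invr_gt0.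
  by rewrite mulrAC ler_pM2r ?invr_gt0 // lagrangian_L_le.
rewrite {1}/log2 lnM ?posrE ?invr_gt0 // -/l.
rewrite mulrDl -/(log2 _).
have : log2 (B / M0) <= `|log2 (B / M0)| * l.
  by apply: (le_trans (ler_norm _)); rewrite ler_peMr.
lra.
Qed.

Lemma small_tolerance_cost :
  Num.sqrt (Num.max (L / mubar) 1) * lnpp (D * L / subproblem_tol P eps eps)
    + log2p (L / M0)
  <= small_const * ((Num.sqrt eps)^-1 * ln eps^-1).
Proof.
have l1 := ln_inv_ge1; set l := ln eps^-1 in l1 *.
have r1 : 1 <= (Num.sqrt eps)^-1.
  by rewrite -sqrtrV ?(ltW eps0) // -[leLHS]sqrtr1 ler_wsqrtr.
rewrite /small_const [leRHS]mulrDl; apply: lerD.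
  rewrite mulrACA; apply: ler_pM; rewrite ?sqrtr_ge0 //.
  - exact: le_trans (lnpp_ge1 _).
  - exact: sqrt_condition_le.
  - exact: lnpp_ratio_le.
apply: (le_trans log2p_ratio_le); rewrite -/l ler_wpM2l //.
  by rewrite addr_ge0 // invr_ge0 ltW // ln2_gt0.
by rewrite ler_peMl // (le_trans ler01).
Qed.

End SmallTolerance.

Theorem theorem3p5 (R : realType) (chi : R) (chi01 : 0 < chi < 1) :
  (forall pi0 kappa0 : R, 0 < pi0 -> 0 < kappa0 ->
   exists2 C : R, 0 < C &
   forall (n m : nat) (P : problem R n m) (mubar mu0 M0 : R)
     (z0 : 'cV[R]_n) (p0 : 'cV[R]_m) (eps rho : R),
   oial_setting P mubar mu0 M0 z0 -> 0 < eps -> 0 < rho ->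
   pi0 <= dual_dist2 P p0 -> kappa0 <= lagrangian_L P eps / mubar ->
   oial_solves_within P chi mu0 M0 eps rho z0 p0
     (C * (1 + oial_bound (dual_dist2 P p0) (mu0 / mubar)
                 (lagrangian_L P eps / mubar) (dom_diam P) (lagrangian_L P eps)
                 (subproblem_tol P eps rho) M0)))
  /\
  (exists2 C : R, 0 < C &
   forall (n m : nat) (P : problem R n m) (mubar mu0 M0 : R)
     (z0 : 'cV[R]_n) (p0 : 'cV[R]_m) (eps rho : R),
   oial_setting P mubar mu0 M0 z0 -> 0 < eps -> 0 < rho ->
   oial_solves_within P chi mu0 M0 eps rho z0 p0
     (C * (1 + oial_bound (Num.max (dual_dist2 P p0) 1) (mu0 / mubar)
                 (Num.max (lagrangian_L P eps / mubar) 1) (dom_diam P)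
                 (lagrangian_L P eps) (subproblem_tol P eps rho) M0)))
  /\
  (forall (n m : nat) (P : problem R n m) (mubar mu0 M0 : R)
     (z0 : 'cV[R]_n) (p0 : 'cV[R]_m),
   oial_setting P mubar mu0 M0 z0 ->
   exists2 C : R, 0 < C &
   \forall eps \near (0 : R)^'+,
     oial_solves_within P chi mu0 M0 eps eps z0 p0
       (C * ((Num.sqrt eps)^-1 * ln eps^-1))).

Proof.
have C0 := cost_const_gt0 chi01.
split; last split.
- move=> pi0 kappa0 pi0_gt0 kappa0_gt0.
  (* [K] absorbs the maximum of the condition number with 1, and
     [2 + pi0^-1] the outer iteration beyond [2 Pi] *)
  pose K := 1 + (Num.sqrt kappa0)^-1.
  have K0 : 0 <= (Num.sqrt kappa0)^-1 by rewrite invr_ge0 sqrtr_ge0.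
  have P0 : 0 < pi0^-1 by rewrite invr_gt0.
  have K1 : 1 <= K by rewrite lerDl.
  exists ((2 + pi0^-1) * (cost_const chi * K)).
    by rewrite mulr_gt0 ?addr_gt0 // mulr_gt0 // (lt_le_trans ltr01).
  move=> n m P mubar mu0 M0 z0 p0 eps rho setting eps0 rho0 pi_le kappa_le.
  have := @oial_solves_within_explicit _ _ _ _ P _ _ _ _ p0 _ _ chi01 setting eps0 rho0.
  apply: oial_solves_within_mono; rewrite /oial_bound.
  set Pi := dual_dist2 P p0 in pi_le *; set c : R := _%:~R.
  set kappa := lagrangian_L P eps / mubar in kappa_le *.
  set Y := lnpp _; set l := log2p _.
  have c1 : 1 <= c by exact: restart_max_ge1.
  have Y1 : 1 <= Y by exact: lnpp_ge1.
  have l0 : 0 <= l by exact: log2p_ge0.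
  have Pi0 : 0 < Pi by exact: lt_le_trans pi_le.
  have kappa_gt0 : 0 < kappa by exact: lt_le_trans kappa_le.
  have sK : Num.sqrt (Num.max kappa 1) <= K * Num.sqrt kappa.
    have sk1 : 1 <= (Num.sqrt kappa0)^-1 * Num.sqrt kappa.
      rewrite mulrC ler_pdivlMr ?sqrtr_gt0 // mul1r; exact: ler_wsqrtr.
    rewrite mulrDl mul1r maxEle; case: ifP => _.
      by rewrite sqrtr1; apply: (le_trans sk1); rewrite lerDr sqrtr_ge0.
    by rewrite lerDl mulr_ge0 ?sqrtr_ge0.
  have PiK : 2 * Pi + 1 <= (2 + pi0^-1) * Pi.
    by rewrite [leRHS]mulrDl lerD2l mulrC ler_pdivlMr // mul1r.
  have W0 : 0 <= Num.sqrt kappa * Y + l.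
    by rewrite addr_ge0 // mulr_ge0 ?sqrtr_ge0 // (le_trans ler01).
  have W'0 : 0 <= Num.sqrt (Num.max kappa 1) * Y + l.
    by rewrite addr_ge0 // mulr_ge0 ?sqrtr_ge0 // (le_trans ler01).
  have WK : Num.sqrt (Num.max kappa 1) * Y + l <= K * (Num.sqrt kappa * Y + l).
    by rewrite mulrDr mulrA lerD ?ler_peMl // ler_wpM2r // (le_trans ler01).
  have c0 : 0 <= c by apply: le_trans c1.
  apply: (@le_trans _ _ ((2 + pi0^-1) * Pi *
            (cost_const chi * (c * (K * (Num.sqrt kappa * Y + l)))))).
    apply: ler_pM => //; first by lra.
      by rewrite mulr_ge0 ?(ltW C0) // mulr_ge0.
    by rewrite ler_pM2l // ler_wpM2l.
  set W := Num.sqrt kappa * Y + l in W0 *.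
  rewrite (_ : _ * Pi * _ = (2 + pi0^-1) * (cost_const chi * K) * (Pi * c * W)).
    have CK0 : 0 <= cost_const chi * K.
      by rewrite mulr_ge0 ?(ltW C0) // (le_trans ler01).
    by rewrite ler_wpM2l ?lerDr // mulr_ge0 // addr_ge0 // ltW.
  by ring.
- exists (3 * cost_const chi); first by rewrite mulr_gt0.
  move=> n m P mubar mu0 M0 z0 p0 eps rho setting eps0 rho0.
  have := @oial_solves_within_explicit _ _ _ _ P _ _ _ _ p0 _ _ chi01 setting eps0 rho0.
  apply: oial_solves_within_mono; rewrite /oial_bound.
  set Pi := dual_dist2 P p0; set c : R := _%:~R.
  set W := _ + log2p _.
  have c1 : 1 <= c by exact: restart_max_ge1.
  have c0 : 0 <= c by apply: le_trans c1.
  have W0 : 0 <= W.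
    rewrite addr_ge0 ?log2p_ge0 // mulr_ge0 ?sqrtr_ge0 //.
    exact: le_trans (lnpp_ge1 _).
  have PiK : 2 * Pi + 1 <= 3 * Num.max Pi 1.
    have : Pi <= Num.max Pi 1 by rewrite le_max lexx.
    have : 1 <= Num.max Pi 1 by rewrite le_max lexx orbT.
    lra.
  have CW0 : 0 <= cost_const chi * (c * W) by rewrite mulr_ge0 ?(ltW C0) // mulr_ge0.
  apply: (le_trans (ler_wpM2r CW0 PiK)).
  rewrite (_ : 3 * Num.max Pi 1 * (cost_const chi * (c * W)) =
    3 * cost_const chi * (Num.max Pi 1 * c * W)); last by ring.
  by rewrite ler_wpM2l ?lerDr // mulr_ge0 ?(ltW C0).
- move=> n m P mubar mu0 M0 z0 p0 setting.
  pose c : R := (Num.ceil (log2pp (mu0 / mubar)))%:~R.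
  have c1 : 1 <= c by exact: restart_max_ge1.
  have Pi0 : 0 <= dual_dist2 P p0 by exact: sqr_ge0.
  exists ((2 * dual_dist2 P p0 + 1) * (cost_const chi *
            (c * small_const P mubar M0))).
    have s0 := small_const_gt0 P mubar M0; have c0 := lt_le_trans ltr01 c1.
    have P1 : 0 < 2 * dual_dist2 P p0 + 1 by lra.
    by rewrite mulr_gt0 // mulr_gt0 // mulr_gt0.
  near=> eps.
  have eps0 : 0 < eps by near: eps; exact: nbhs_right_gt.
  have eps_small : eps < expR (- 1).
    by near: eps; apply: nbhs_right_lt; exact: expR_gt0.
  have := @oial_solves_within_explicit _ _ _ _ P _ _ _ _ p0 _ _ chi01 setting eps0 eps0.
  apply: oial_solves_within_mono; rewrite -/c.
  have P1 : 0 <= 2 * dual_dist2 P p0 + 1 by lra.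
  set X := (Num.sqrt eps)^-1 * ln eps^-1.
  rewrite (_ : _ * X = (2 * dual_dist2 P p0 + 1) *
    (cost_const chi * (c * (small_const P mubar M0 * X)))); last by ring.
  rewrite ler_wpM2l // ler_wpM2l ?(ltW C0) // ler_wpM2l ?(le_trans ler01 c1) //.
  exact (small_tolerance_cost setting eps0 eps_small).
Unshelve. all: by end_near.
Qed.
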